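(* Let $R$ be a finite $5$-centralizer ring. Then $\Gamma_R$ is integral but not toroidal. Also, $\Gamma_R$ is planar if and only if $|Z(R)| = 1$ or $2$.
   Context: Rings are associative and not assumed to have a multiplicative identity. For a ring $R$, $Z(R)$ is its center and $C_R(r) = \{s \in R : rs = sr\}$ is the centralizer of $r \in R$. $R$ is an $n$-centralizer ring if the set $\{C_R(r) : r \in R\}$ of distinct centralizers has exactly $n$ elements. The commuting graph $\Gamma_R$ of a non-commutative ring $R$ is the simple undirected graph with vertex set $R \setminus Z(R)$ in which two distinct vertices $x,y$ are adjacent if and only if $xy = yx$. A graph is integral if all eigenvalues of its adjacency matrix are integers. The genus $\gamma(\mathcal{G})$ is the smallest non-negative integer $g$ such that $\mathcal{G}$ embeds in the surface obtained by attaching $g$ handles to a sphere; $\mathcal{G}$ is planar if $\gamma(\mathcal{G}) = 0$ and toroidal if $\gamma(\mathcal{G}) = 1$. *)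

(* Defs.v *)
From HB Require Import structures.
From mathcomp Require Import all_boot all_order all_algebra all_field.
From mathcomp Require Import all_classical all_reals all_analysis.

Set Implicit Arguments.
Unset Strict Implicit.
Unset Printing Implicit Defensive.

Import Order.TTheory GRing.Theory Num.Theory.
Import numFieldNormedType.Exports.

Local Open Scope ring_scope.

(* MathComp rings have a unit, so a ring not assumed to have one is a         *)
(* [zmodType] together with an associative, distributive [mul].               *)
Section Centralizers.
Context {R : finZmodType}.
Variable mul : R -> R -> R.

Definition ring_centralizer (r : R) : {set R} :=
  finset (fun s => mul r s == mul s r).

Definition ring_center : {set R} :=
  finset (fun z => [forall s, mul z s == mul s z]).

Definition n_centralizer (n : nat) : Prop :=
  #|[set ring_centralizer r | r in R]%SET| = n.

Definition commuting_vertex : finType := {x : R | x \notin ring_center}.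

Definition commuting_graph : rel commuting_vertex :=
  fun x y => (x != y) && (mul (val x) (val y) == mul (val y) (val x)).

End Centralizers.

Arguments commuting_graph {R} mul _ _.

Section IntegralGraphs.
Context {V : finType}.
Variable adj : rel V.

Definition adjacency_matrix : 'M[algC]_#|V| :=
  \matrix_(i, j) (adj (enum_val i) (enum_val j))%:R.

(* The eigenvalues of an integer matrix are algebraic, so [algC] contains all *)
(* of its complex eigenvalues.                                                *)
Definition integral_graph : Prop :=
  forall a : algC, eigenvalue adjacency_matrix a -> a \is a Num.int.

End IntegralGraphs.

Local Open Scope classical_set_scope.

Section Genus.
Variable K : realType.

(* The sphere of radius 3g + 1 centred at the origin of K^3, with g handles   *)
(* attached.  For i < g, the vertical cylinder of radius 1 around (3i, 0)     *)
(* cuts two discs off the sphere; these open discs are removed, and the part  *)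
(* of the cylinder inside the sphere is the tube glued to their boundaries.   *)
(* The cylinders are pairwise disjoint and stay off the equator.              *)
Definition sphere_with_handles (g : nat) : set (K * K * K) :=
  [set p | let: (x, y, z) := p in
    let rho := (3 * g + 1)%N%:R : K in
    let axis_dist2 (i : nat) := (x - (3 * i)%N%:R) ^+ 2 + y ^+ 2 in
       (x ^+ 2 + y ^+ 2 + z ^+ 2 = rho ^+ 2 /\
        forall i : nat, (i < g)%N -> 1 <= axis_dist2 i)
    \/ (x ^+ 2 + y ^+ 2 + z ^+ 2 <= rho ^+ 2 /\
        exists2 i : nat, (i < g)%N & axis_dist2 i = 1)].

Definition is_arc (S : set (K * K * K)) (a b : K * K * K)
    (f : K -> K * K * K) : Prop :=
  [/\ {within `[0, 1], continuous f},
      {in `[0, 1]%R &, injective f},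
      forall t : K, t \in `[0, 1]%R -> S (f t),
      f 0 = a
    & f 1 = b].

(* Embedding of a simple graph ([adj] symmetric and irreflexive) in [S]:      *)
(* [arc u v] is the edge {u, v}, traversed from u to v.                       *)
Definition embeds_in (V : finType) (adj : rel V) (S : set (K * K * K)) : Prop :=
  exists (pt : V -> K * K * K) (arc : V -> V -> K -> K * K * K),
    [/\ injective pt /\ forall v, S (pt v),
        forall u v, adj u v -> is_arc S (pt u) (pt v) (arc u v),
        forall u v, adj u v -> forall t : K, t \in `[0, 1]%R ->
          arc v u t = arc u v (1 - t),
        forall u v w, adj u v -> forall t : K, t \in `]0, 1[%R -> arc u v t <> pt w
      & forall u v u' v', adj u v -> adj u' v' ->
          (u, v) <> (u', v') -> (u, v) <> (v', u') ->
          forall t t' : K, t \in `]0, 1[%R -> t' \in `]0, 1[%R ->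
          arc u v t <> arc u' v' t'].

Definition has_genus (V : finType) (adj : rel V) (g : nat) : Prop :=
  embeds_in adj (sphere_with_handles g) /\
  forall h : nat, (h < g)%N -> ~ embeds_in adj (sphere_with_handles h).

Definition planar (V : finType) (adj : rel V) : Prop := has_genus adj 0.

Definition toroidal (V : finType) (adj : rel V) : Prop := has_genus adj 1.

End Genus.

(* Main.v *)
Require Import Defs.
From mathcomp Require Import all_boot all_order all_algebra all_field.
From mathcomp Require Import all_classical all_reals all_analysis.
From mathcomp Require Import zify ring lra.

Set Implicit Arguments.
Unset Strict Implicit.
Unset Printing Implicit Defensive.

Import Order.TTheory GRing.Theory Num.Theory.
Import numFieldNormedType.Exports.

Local Open Scope ring_scope.

(** Modulo its center Z, a ring R with five centralizers is elementary abelian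
    of order 9. Indeed, if [x, y] is nonzero, the elements x + k y for different
    k, and y, have different centralizers as long as the differences k - k' do
    not kill [x, y]; since only four centralizers are proper, commutators have
    order 2 or 3. Order 2 is excluded by looking at the centralizers of x, y, x
    + y, a fourth element and their sums; in order 3 the centralizer of any
    noncentral x is the union of Z, Z + x and Z - x ([commuting_classes]). So
    the commuting graph is a disjoint union of four cliques with m = 2 |Z|
    vertices each. Its spectrum consists of - 1 and m - 1
    ([clique_union_integral]). If |Z| is 1 or 2, four cliques with at most four
    vertices are easily drawn on the sphere ([four_K4_in_sphere]), so the genus
    is 0. If |Z| is at least 3, each clique has at least six vertices, and it
    remains to see that K6 does not embed in the sphere, nor two disjoint copies
    of K5 in the torus; this makes the graph neither planar nor toroidal.

    Arcs are arbitrary continuous curves. Instead of the Jordan curve theorem,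
    the proof uses continuous choices of an angle along a nonvanishing planar
    field ([angle_lift], [turns_square]). If e and f are disjoint arcs in the
    plane, e(s) - f(t) is such a field on a square, and the total turning around
    the boundary of the square is zero. Adding up these relations over all pairs
    of disjoint edges of a drawing of K5 gives a contradiction modulo 2
    ([K5_nonplanar]); this is a continuous version of the van Kampen
    obstruction. On the sphere, a sixth vertex is a center of stereographic
    projection to the plane ([K5_punctured_sphere]).

    On the torus, two angles lift each drawing to the universal cover, up to a
    holonomy in the lattice for each edge. If all the holonomies of a copy of K5
    lie on one line, this copy lifts to an annulus, hence to the plane, which is
    impossible ([torus_lift_rank2]). So the first copy contains a loop with
    nonzero homology class, and the second a loop whose class is not
    proportional to it. Two such loops meet ([torus_loops_meet]), by the theorem
    of Poincare and Miranda, which also follows from the vanishing of the total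
    turning; but the two copies are disjoint ([two_K5_torus]). *)

(** * Commuting classes of a ring with five centralizers *)

Section FiveCentralizers.
Context {R : finZmodType} (mul : R -> R -> R).
Hypothesis mulDl : left_distributive mul +%R.
Hypothesis mulDr : right_distributive mul +%R.

Let br (x y : R) : R := mul x y - mul y x.
Let C := ring_centralizer mul.
Let central (z : R) : Prop := forall v, br z v = 0.

Let brDl x x' y : br (x + x') y = br x y + br x' y.
Proof. by rewrite /br mulDl mulDr opprD addrACA. Qed.

Let brC x y : br x y = - br y x.
Proof. by rewrite /br opprB. Qed.

Let brDr x y y' : br x (y + y') = br x y + br x y'.
Proof. by rewrite brC brDl opprD -!brC. Qed.

Let br0l y : br 0 y = 0.
Proof. by apply: (addrI (br 0 y)); rewrite -brDl !addr0. Qed.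

Let brxx x : br x x = 0. Proof. by rewrite /br subrr. Qed.

Let brNl x y : br (- x) y = - br x y.
Proof. by apply: (addrI (br x y)); rewrite -brDl !subrr br0l. Qed.

Let brNr x y : br x (- y) = - br x y.
Proof. by rewrite brC brNl -brC. Qed.

Let brMnl x y n : br (x *+ n) y = br x y *+ n.
Proof. by elim: n => [|n IH]; rewrite ?mulr0n ?br0l // !mulrS brDl IH. Qed.

Let brMnr x y n : br x (y *+ n) = br x y *+ n.
Proof. by rewrite brC brMnl -mulNrn -brC. Qed.

Let inC x v : (v \in C x) = (br x v == 0).
Proof. by rewrite inE /br subr_eq0. Qed.

Let br_swap0 x y : (br x y == 0) = (br y x == 0).
Proof. by rewrite brC oppr_eq0. Qed.

Let eqC x y v : C x = C y -> br x v = 0 -> br y v = 0.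
Proof. by move=> e /eqP; rewrite -inC e inC => /eqP. Qed.

Let eqC_br x y : (forall v, br x v = br y v) -> C x = C y.
Proof. by move=> e; apply/setP => v; rewrite !inC e. Qed.

Let neqC x y : br x y != 0 -> C x != C y.
Proof. by apply: contra_neq => /esym/eqC; apply. Qed.

Let centralP z : reflect (central z) (z \in ring_center mul).
Proof.
rewrite inE; apply: (iffP forallP) => h v.
  by apply/eqP; rewrite subr_eq0; exact: h.
by have /eqP := h v; rewrite subr_eq0.
Qed.

Let noncentralP x : x \notin ring_center mul -> exists y, br x y != 0.
Proof.
move=> /centralP nc; apply: contrapT => all0; apply: nc => v.
by apply/eqP/negPn/negP => h; apply: all0; exists v.
Qed.

Let br_noncentral x y : br x y != 0 -> x \notin ring_center mul.
Proof. by apply: contra_neqN => /centralP. Qed.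

Let eqC_central x y : central (x - y) -> C x = C y.
Proof. by move=> h; apply: eqC_br => v; rewrite -{1}(subrK y x) brDl h add0r. Qed.

Hypothesis R5 : n_centralizer mul 5.

Let cents : {set {set R}} := [set C r | r in R]%SET.

Let uniq_size s : uniq (map C s) -> (size s <= 5)%N.
Proof.
move=> u; rewrite -R5 -(size_map C) -(card_uniqP u); apply: subset_leq_card.
by apply/fintype.subsetP => A /mapP[r _ ->]; apply/imsetP; exists r.
Qed.

Let uniq_cover s v : uniq (map C s) -> size s = 5 -> C v \in map C s.
Proof.
move=> u s5; have [//|nin] := boolP (C v \in map C s).
by have := @uniq_size (v :: s); rewrite /= nin u s5 => /(_ isT).
Qed.

Let uniq_extend s : (size s < 5)%N -> exists v, C v \notin map C s.
Proof.
move=> s5; apply: contrapT => all; have : (#|cents| <= size (map C s))%N.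
  apply: leq_trans (card_size _); apply: subset_leq_card.
  apply/fintype.subsetP => A /imsetP[r _ ->]; apply/negPn/negP => nin.
  by apply: all; exists r.
by rewrite size_map R5 leqNgt s5.
Qed.

Let pairwise_uniq s : pairwise (fun a b => br a b != 0) s -> (1 < size s)%N ->
  uniq (map C (0 :: s)).
Proof.
move=> pw s1 /=; apply/andP; split.
  case: s s1 pw => [|a [|b s]] // _ pw.
  have ext x y : br x y != 0 -> C 0 != C x.
    by apply: contra_neq => e; apply: (eqC e); rewrite br0l.
  apply/mapP => -[r rs e].
  suff [y bry] : exists y, br r y != 0 by have := ext _ _ bry; rewrite e eqxx.
  move: rs pw; rewrite in_cons => /orP[/eqP -> /= /andP[/andP[ab _] _]|rs].
    by exists b.
  rewrite pairwise_cons => /andP[/allP as0 _].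
  by exists a; rewrite br_swap0; exact: as0.
elim: s pw {s1} => //= a s IH /andP[/allP as0 /IH ->]; rewrite andbT.
by apply/mapP => -[r /as0 ar e]; have := neqC ar; rewrite e eqxx.
Qed.

(** The centralizers of y, x, x + y, x + 2y and x + 3y would be distinct and
    proper if [x, y] were not killed by 2 or 3. *)
Let br_torsion x y : br x y *+ 2 = 0 \/ br x y *+ 3 = 0.
Proof.
have [->|c0] := eqVneq (br x y) 0; first by left; rewrite mul0rn.
have [->|c2] := eqVneq (br x y *+ 2) 0; first by left.
have [->|c3] := eqVneq (br x y *+ 3) 0; first by right.
pose s := [:: x; x + y; x + y *+ 2; x + y *+ 3; y].
have E i j : br (x + y *+ i) (x + y *+ j) = br x y *+ j - br x y *+ i.
  rewrite brDl !brDr brxx add0r brMnr !brMnl brMnr brxx !mul0rn addr0.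
  by rewrite (brC y x) mulNrn.
have En i : br (x + y *+ i) y = br x y.
  by rewrite brDl brMnl brxx mul0rn addr0.
have pw : pairwise (fun a b => br a b != 0) s.
  have x0 : x = x + y *+ 0 by rewrite mulr0n addr0.
  have x1 : x + y = x + y *+ 1 by rewrite mulr1n.
  rewrite /s /= [x in br x](x0) x1 !E !En.
  by rewrite !mulr0n !subr0 -!mulrnBr // c0 c2 c3.
by have := uniq_size (pairwise_uniq pw isT).
Qed.

(** With commutators [a, b] of order 2 and [c, d] of order 3, the elements 3 a +
    4 c and 3 b + 4 d would have a commutator of order 6. *)
Let br_torsion_uniform :
  (forall x y, br x y *+ 2 = 0) \/ (forall x y, br x y *+ 3 = 0).
Proof.
have [all3|] := pselect (forall x y, br x y *+ 3 = 0); first by right.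
move=> not3; left => c d; apply: contrapT => n2; apply: not3 => a b.
apply: contrapT => n3.
have cd3 : br c d *+ 3 = 0 by case: (br_torsion c d).
have ab2 : br a b *+ 2 = 0 by case: (br_torsion a b).
have t12 x y : br x y *+ 12 = 0.
  by case: (br_torsion x y) => h; [rewrite (mulrnA _ 2 6) h mul0rn | rewrite (mulrnA _ 3 4) h mul0rn].
have e : br (a *+ 3 + c *+ 4) (b *+ 3 + d *+ 4) = br a b + br c d.
  have M n m u v : br (u *+ n) (v *+ m) = br u v *+ (m * n) by rewrite brMnl brMnr mulrnA.
  rewrite brDl (brDr (a *+ 3)) (brDr (c *+ 4)) !M.
  rewrite (t12 a d) (t12 c b) add0r addr0.
  rewrite (_ : 3 * 3 = 2 * 4 + 1)%N // (_ : 4 * 4 = 3 * 5 + 1)%N //.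
  by rewrite !mulrnDr !mulrnA ab2 cd3 !mul0rn !add0r !mulr1n.
have := br_torsion (a *+ 3 + c *+ 4) (b *+ 3 + d *+ 4).
rewrite e (mulrnDl 2) (mulrnDl 3) ab2 cd3 add0r addr0.
by case=> h; [exact: n2 | exact: n3].
Qed.

Let noncommuting_pair : exists x y, br x y != 0.
Proof.
apply: contrapT => comm; have [v] := @uniq_extend [:: 0] isT.
rewrite inE => /eqP; apply; apply: eqC_br => w; rewrite br0l.
by apply/eqP/negPn/negP => h; apply: comm; exists v, w.
Qed.

(** In the 2-torsion case x, y and x + y have three proper centralizers, which
    leaves a fourth one, of z; the sums of elements with these centralizers
    admit no consistent choice among the four. *)
Let not_two_torsion : ~ forall x y, br x y *+ 2 = 0.
Proof.
move=> t2; have [x [y xy]] := noncommuting_pair.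
have opp v w : - br v w = br v w.
  by apply/eqP; rewrite eq_sym -subr_eq0 opprK -mulr2n t2.
have sym v w : br v w = br w v by rewrite brC opp.
have dbl v w : br v w + br v w = 0 by rewrite -mulr2n t2.
pose r := x + y.
have yx : br y x != 0 by rewrite sym.
have xr : br x r != 0 by rewrite /r brDr brxx add0r.
have yr : br y r != 0 by rewrite /r brDr brxx addr0.
have u3 : uniq (map C [:: 0; x; y; r]).
  by apply: pairwise_uniq => //=; rewrite xy xr yr.
have [z zC] := @uniq_extend [:: 0; x; y; r] isT.
have cover v w : br v w != 0 ->
    C v = C x \/ C v = C y \/ C v = C r \/ C v = C z.
  move=> vw; have := @uniq_cover [:: z; 0; x; y; r] v.
  rewrite [uniq _]/= zC => /(_ u3 erefl).
  rewrite !inE => /or4P[/eqP e|/eqP e|/eqP e|/orP[/eqP e|/eqP e]]; try tauto.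
  by have := eqC (esym e) (br0l w); move/eqP; rewrite (negbTE vw).
have rE v : br r v = br x v + br y v by rewrite /r brDl.
have [zx zy zr] : [/\ C z <> C x, C z <> C y & C z <> C r].
  by move: zC; rewrite !inE !negb_or => /and4P[_ /eqP ? /eqP ? /eqP ?].
have z0 : C z <> C 0 by move: zC; rewrite !inE !negb_or => /andP[/eqP].
have znc : ~ central z.
  by move=> h; apply: z0; apply: eqC_br => v; rewrite br0l h.
(* A noncentral w with these properties would have the fourth centralizer; an
   element u that does not commute with w has then the centralizer of some p
   among x, y and x + y, which is also the centralizer of p + w. *)
have W w : br x w = 0 -> br y w = 0 -> central w.
  move=> xw yw; apply: contrapT => wnc.
  have [u wu] : exists u, br w u != 0.
    by apply: noncentralP; apply/negP => /centralP.
  have rw : br r w = 0 by rewrite rE xw yw addr0.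
  have wz : C w = C z.
    have absurd p q : br p q != 0 -> br q w = 0 -> C w <> C p.
      move=> pq qw e; have := eqC e (etrans (sym w q) qw).
      by move/eqP; rewrite (negbTE pq).
    case: (cover w u wu) => [e|[e|[e|//]]]; exfalso.
    - exact: (absurd x y).
    - exact: (absurd y x).
    - by apply: (absurd r x) => //; rewrite sym.
  have shift p q s : br p q != 0 -> br p s != 0 -> br p w = 0 -> br q w = 0 ->
      br s w = 0 -> C (p + w) <> C q /\ C (p + w) <> C s /\ C (p + w) <> C z.
    move=> pq ps pw qw sw.
    have nq : br (p + w) q != 0 by rewrite brDl (sym w) qw addr0.
    split; [|split] => e.
    - have := eqC (esym e) (brxx q); move/eqP; rewrite (negbTE nq) //.
    - have := eqC (esym e) (brxx s); move/eqP.
      by rewrite brDl (sym w) sw addr0 (negbTE ps).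
    - rewrite -wz in e; have := eqC (esym e) (etrans (sym w q) qw).
      by move/eqP; rewrite (negbTE nq).
  have fin p q s : br p q != 0 -> br p s != 0 -> br p w = 0 -> br q w = 0 ->
      br s w = 0 -> (forall v u, br v u != 0 -> C v = C p \/ C v = C q \/ C v = C s \/ C v = C z) ->
      C u <> C p.
    move=> pq ps pw qw sw cov e.
    have [n1 [n2 n3]] := shift p q s pq ps pw qw sw.
    have nq : br (p + w) q != 0 by rewrite brDl (sym w) qw addr0.
    have [e'|[//|[//|//]]] := cov _ _ nq.
    have pu : br p u = 0 by apply: eqC e (brxx u).
    have := eqC (esym e') pu; rewrite brDl pu add0r.
    by move/eqP; rewrite (negbTE wu).
  have uw : br u w != 0 by rewrite sym.
  case: (cover u w uw) => [|[|[|e]]].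
  - apply: (fin x y r) => //.
  - apply: (fin y x r) => // v v' /cover; tauto.
  - by apply: (fin r x y); rewrite // 1?sym // => v v' /cover; tauto.
  - rewrite -wz in e; have := eqC e (brxx u).
    by move/eqP; rewrite (negbTE wu).
(* If z commuted with p, the element z + q could only have the centralizer of s,
   and then z - p would be central. *)
have out p q s : br p q != 0 -> (forall v, br s v = br p v + br q v) ->
    (forall v, br p v = 0 -> br q v = 0 -> central v) ->
    C z <> C p ->
    (forall v u, br v u != 0 -> C v = C p \/ C v = C q \/ C v = C s \/ C v = C z) ->
    br p z != 0.
  move=> pq sE Wpq zp cov; apply/eqP => pz.
  have qz : br q z != 0 by apply/eqP => qz; apply: znc; exact: Wpq.
  have np : br (z + q) p != 0 by rewrite brDl (sym z) pz add0r sym.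
  have [e|[e|[e|e]]] := cov _ _ np.
  - by have := eqC (esym e) (brxx p); move/eqP; rewrite (negbTE np).
  - have := eqC (esym e) (brxx q); move/eqP.
    by rewrite brDl brxx addr0 sym (negbTE qz).
  - have := eqC e (brxx (z + q)); rewrite sE !brDr pz brxx add0r addr0 => h.
    apply: zp; apply: eqC_central; apply: Wpq; rewrite brDr brNr.
      by rewrite pz brxx subrr.
    by rewrite (sym q p) opp addrC.
  - have := eqC (esym e) (brxx z); rewrite brDl brxx add0r => /eqP.
    by rewrite (negbTE qz).
have X0 : br x z != 0 by apply: (out x y r) => //; exact: cover.
have Y0 : br y z != 0.
  apply: (out y x r) => //; first by move=> v; rewrite rE addrC.
    by move=> v yv xv; exact: W.
  by move=> v u /cover; tauto.
have XY0 : br r z != 0.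
  apply: (out r y x) => //; first by rewrite sym.
  - by move=> v; rewrite rE -addrA dbl addr0.
  - move=> v rv yv; apply: W => //; by rewrite -rv rE yv addr0.
  - by move=> v u /cover; tauto.
rewrite rE in XY0.
(* Indeed z + p commutes neither with p nor with z. *)
have sum p q s : br p z != 0 ->
    (forall v u, br v u != 0 -> C v = C p \/ C v = C q \/ C v = C s \/ C v = C z) ->
    br q (z + p) = 0 \/ br s (z + p) = 0.
  move=> pz cov; have np : br (z + p) z != 0 by rewrite brDl brxx add0r.
  case: (cov _ _ np) => [e|[e|[e|e]]].
  - have := eqC e (brxx (z + p)); rewrite brDr brxx addr0 => /eqP.
    by rewrite (negbTE pz).
  - by left; exact: eqC e (brxx _).
  - by right; exact: eqC e (brxx _).
  - have := eqC e (brxx (z + p)); rewrite brDr brxx add0r sym => /eqP.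
    by rewrite (negbTE pz).
have cancel a b c : a + b = 0 -> c + b = 0 -> a = c :> R.
  by move=> ab cb; apply: (addIr b); rewrite ab cb.
have c1 := sum x y r X0 (fun v u h => cover v u h).
have c2 := sum y x r Y0 (ltac:(move=> v u /cover; tauto)).
have c3 := sum r x y (ltac:(by rewrite rE)) (ltac:(move=> v u /cover; tauto)).
rewrite !rE /r !brDr !brxx add0r addr0 (sym y x) in c1 c2 c3.
have same a : a + br x y = 0 -> a = br x y by move=> h; apply: cancel h (dbl x y).
have c12 : ~ (br x z = br x y /\ br y z = br x y).
  by move=> [a b]; move: XY0; rewrite a b dbl eqxx.
have c13 : ~ (br x z + br y z = br x y /\ br x z = br x y).
  by move=> [ab a]; move: Y0 ab; rewrite a -[RHS]addr0 => /eqP h /addrI.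
have c23 : ~ (br x z + br y z = br x y /\ br y z = br x y).
  by move=> [ab b]; move: X0 ab; rewrite b -[RHS]add0r => /eqP h /addIr.
have {}c1 : br y z = br x y \/ br x z + br y z = br x y.
  by case: c1 => [/same|]; [left | rewrite addrA => /same; right].
have {}c2 : br x z = br x y \/ br x z + br y z = br x y.
  by case: c2 => [/same|]; [left | rewrite addr0 addrAC => /same; right].
have {}c3 : br x z = br x y \/ br y z = br x y.
  by case: c3 => [/same|]; [left | rewrite addr0 => /same; right].
tauto.
Qed.

Let three_torsion x y : br x y *+ 3 = 0.
Proof. by case: br_torsion_uniform => [/not_two_torsion|]. Qed.

Let br2_neq0 x y : br x y != 0 -> br x y *+ 2 != 0.
Proof.
by apply: contra_neq => h; rewrite -(three_torsion x y) mulrS h addr0.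
Qed.

Section Pair.
Variables (x y : R).
Hypothesis xy : br x y != 0.

Let reps := [:: x; y; x + y; x - y].

Lemma reps_pairwise : pairwise (fun a b => br a b != 0) reps.
Proof.
have yx : br y x != 0 by rewrite br_swap0.
rewrite /= !(brDl, brDr, brNr, brxx, add0r, addr0, subr0) oppr_eq0 xy yx /=.
by rewrite (brC y x) -opprD oppr_eq0 -mulr2n br2_neq0.
Qed.

Lemma reps_uniq : uniq (map C (0 :: reps)).
Proof. exact: pairwise_uniq reps_pairwise isT. Qed.

Lemma reps_cover v w : br v w != 0 ->
  C v = C x \/ C v = C y \/ C v = C (x + y) \/ C v = C (x - y).
Proof.
move=> vw; have := @uniq_cover (0 :: reps) v reps_uniq erefl.
rewrite !inE => /or4P[/eqP e|/eqP e|/eqP e|/orP[/eqP e|/eqP e]]; try tauto.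
by have := eqC (esym e) (br0l w); move/eqP; rewrite (negbTE vw).
Qed.

(** Otherwise x and y both commute with v, hence with one of the four
    representatives, which is not the case. *)
Lemma pair_central v : br x v = 0 -> br y v = 0 -> central v.
Proof.
move=> xv yv; apply: contrapT => vnc.
have [w vw] : exists w, br v w != 0.
  by apply: noncentralP; apply/negP => /centralP.
have vx : br v x = 0 by rewrite brC xv oppr0.
have vy : br v y = 0 by rewrite brC yv oppr0.
have yx : br y x != 0 by rewrite br_swap0.
have xy' := negP xy; have yx' := negP yx.
case: (reps_cover vw) => [e|[e|[e|e]]].
- by have /eqP := eqC e vy.
- by have /eqP := eqC e vx.
- by have /eqP := eqC e vx; rewrite brDl brxx add0r.
- by have /eqP := eqC e vx; rewrite brDl brNl brxx add0r oppr_eq0.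
Qed.

(** The centralizer of v + y can only be that of x + y or x - y; accordingly v -
    x or v + x commutes with y as well as with x. *)
Lemma commuting_cosets v : br x v = 0 ->
  central v \/ central (v - x) \/ central (v + x).
Proof.
move=> xv; have [yv|yv] := eqVneq (br y v) 0; first by left; exact: pair_central.
have vx : br v x = 0 by rewrite brC xv oppr0.
have nvy : br (v + y) x != 0 by rewrite brDl vx add0r br_swap0.
have xvy : br x (v + y) = br x y by rewrite brDr xv add0r.
have yvy : br y (v + y) = br y v by rewrite brDr brxx addr0.
right; case: (reps_cover nvy) => [e|[e|[e|e]]].
- by have /eqP := eqC e (brxx _); rewrite xvy (negbTE xy).
- by have /eqP := eqC e (brxx _); rewrite yvy (negbTE yv).
- left; apply: pair_central; rewrite brDr brNr ?xv ?brxx ?subrr //.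
  have := eqC e (brxx _); rewrite brDl xvy yvy => <-.
  by rewrite (brC y x) opprK addrC.
- right; apply: pair_central; rewrite brDr ?xv ?brxx ?addr0 //.
  have := eqC e (brxx _); rewrite brDl brNl xvy yvy => h.
  by rewrite (brC y x) -opprB h oppr0.
Qed.

Lemma coset_centralizer v : v \notin ring_center mul -> br x v = 0 -> C v = C x.
Proof.
move=> vnc /commuting_cosets[/centralP|[|h]]; first by rewrite (negbTE vnc).
  exact: eqC_central.
rewrite (@eqC_central v (- x)) ?opprK //; apply/setP => w.
by rewrite !inC brNl oppr_eq0.
Qed.

(** Apart from the center, the centralizer of x consists of the two cosets of x
    and of - x. *)
Lemma centralizer_card : #|C x :\: ring_center mul| = (2 * #|ring_center mul|)%N.
Proof.
have eqD : C x :\: ring_center mul =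
    [set x + z | z in ring_center mul]%SET :|: [set - x + z | z in ring_center mul]%SET.
  apply/setP => v; rewrite finset.in_setD finset.in_setU inC.
  apply/andP/orP => [[vnc /eqP /commuting_cosets[|[|]] h]|].
  - by move/centralP: h; rewrite (negbTE vnc).
  - by left; apply/imsetP; exists (v - x); [exact/centralP | rewrite addrC subrK].
  - by right; apply/imsetP; exists (v + x); [exact/centralP | rewrite addrC addrK].
  move=> [|] /imsetP[z /centralP zc ->]; split.
  - by apply: (@br_noncentral _ y); rewrite brDl zc addr0.
  - by rewrite brDr brxx add0r brC zc oppr0.
  - by apply: (@br_noncentral _ y); rewrite brDl zc addr0 brNl oppr_eq0.
  - by rewrite brDr brNr brxx oppr0 add0r brC zc oppr0.
rewrite eqD cardsU !card_imset; try exact: addrI.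
rewrite (_ : _ :&: _ = finset.set0) ?cards0 ?subn0 ?mul2n ?addnn //.
apply/setP => v; rewrite finset.in_setI finset.in_set0; apply/negP => /andP[].
move=> /imsetP[z /centralP zc ->] /imsetP[z' /centralP zc' e].
have : br (x + z) y = br (- x + z') y by rewrite e.
rewrite !brDl zc zc' !addr0 brNl => /eqP; rewrite -subr_eq0 opprK -mulr2n.
by apply/negP; exact: br2_neq0.
Qed.
End Pair.

(** The center has index 9, and the four proper centralizers are the subgroups
    of index 3 above it; off the center, two elements commute when they lie in
    the same one. *)
Theorem commuting_classes : exists cls : R -> 'I_4,
  (forall u v, u \notin ring_center mul -> v \notin ring_center mul ->
     (mul u v == mul v u) = (cls u == cls v)) /\
  (forall i, #|[set v | (v \notin ring_center mul) && (cls v == i)]%SET| =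
     (2 * #|ring_center mul|)%N).
Proof.
have [x [y xy]] := noncommuting_pair.
pose reps := [:: x; y; x + y; x - y]; pose Cs := map C reps.
have uCs : uniq Cs by have /andP[] := reps_uniq xy.
have memCs v : v \notin ring_center mul -> C v \in Cs.
  move=> /noncentralP[w vw]; rewrite !inE.
  by have [->|[->|[->|->]]] := reps_cover xy vw; rewrite eqxx ?orbT.
have commE u v : u \notin ring_center mul -> v \notin ring_center mul ->
    (br u v == 0) = (C u == C v).
  move=> unc vnc; apply/idP/idP => [/eqP uv|]; last first.
    by apply: contraTT => /neqC.
  by have [w uw] := noncentralP unc; rewrite (coset_centralizer uw vnc uv).
pose cls v : 'I_4 := inord (index (C v) Cs).
have clsE v : v \notin ring_center mul -> cls v = index (C v) Cs :> nat.
  by move=> /memCs; rewrite -index_mem => ?; rewrite inordK.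
exists cls; split=> [u v unc vnc|i].
  rewrite -subr_eq0 -/(br u v) commE //.
  have -> : (cls u == cls v) = (index (C u) Cs == index (C v) Cs) by rewrite -!clsE.
  apply/eqP/eqP => [-> //|e].
  by rewrite -(nth_index (C 0) (memCs u unc)) e nth_index // memCs.
pose r := nth 0 reps i.
have iCs : C r = nth (C 0) Cs i by rewrite (nth_map 0).
have [w rw] : exists w, br r w != 0.
  have pw := reps_pairwise xy.
  have yx : br y x != 0 by rewrite br_swap0.
  rewrite /r; case: i {r iCs} => -[|[|[|[|//]]]] _ /=.
  - by exists y.
  - by exists x.
  - by exists x; rewrite brDl brxx add0r.
  - by exists x; rewrite brDl brNl brxx add0r oppr_eq0.
rewrite -(centralizer_card rw); apply: eq_card => v.
rewrite finset.in_setD inC [LHS]inE; case: (boolP (v \in ring_center mul)) => //= vnc.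
have rnc := br_noncentral rw.
rewrite (commE r v rnc vnc).
have -> : (cls v == i) = (index (C v) Cs == i) by rewrite -clsE.
rewrite iCs.
apply/eqP/eqP => [<-|<-]; last by rewrite index_uniq.
by rewrite nth_index // memCs.
Qed.
End FiveCentralizers.

(** * The spectrum of a union of cliques *)

(** With B the adjacency matrix plus the identity, B i j tells whether i and j
    are in the same clique, so that B squares to m B: the eigenvalues are - 1
    and m - 1. *)
Lemma clique_union_integral (V : finType) (adj : rel V) (T : eqType) (cls : V -> T)
    (m : nat) :
  (forall u v, adj u v = (u != v) && (cls u == cls v)) ->
  (forall v, #|[set u | cls u == cls v]%SET| = m) ->
  integral_graph adj.
Proof.
move=> adjE clsm a /eigenvalueP[x xA x0].
pose B : 'M[algC]_#|V| := adjacency_matrix adj + 1%:M.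
have BE i j : B i j = (cls (enum_val i) == cls (enum_val j))%:R.
  rewrite !mxE adjE (inj_eq enum_val_inj); case: eqVneq => [->|_] /=.
    by rewrite eqxx add0r.
  by rewrite addr0.
have BB : B *m B = m%:R *: B.
  apply/matrixP => i j; rewrite [LHS]mxE [RHS]mxE BE.
  rewrite (eq_bigr (fun k => (cls (enum_val k) == cls (enum_val i))%:R *
    (cls (enum_val i) == cls (enum_val j))%:R)); last first.
    move=> k _; rewrite !BE; case: (eqVneq (cls (enum_val k)) (cls (enum_val i))) => [->|ki].
      by rewrite ?eqxx.
    by rewrite !mul0r.
  rewrite -mulr_suml; congr (_ * _).
  set c := cls (enum_val i).
  rewrite -(big_enum_val (fun v => (cls v == c)%:R : algC)) /= -(clsm (enum_val i)).
  transitivity (\sum_(v in [set u | cls u == c]%SET) (1 : algC)).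
    by rewrite [RHS]big_mkcond /=; apply: eq_bigr => v _; rewrite inE; case: eqP.
  by rewrite sumr_const.
have xB : x *m B = (a + 1) *: x by rewrite mulmxDr xA mulmx1 scalerDl scale1r.
have : ((a + 1) * (a + 1 - m%:R)) *: x = 0.
  have : x *m (B *m B) = x *m (m%:R *: B) by rewrite BB.
  rewrite mulmxA xB -scalemxAl xB -scalemxAr xB !scalerA => /eqP.
  rewrite -subr_eq0 -scalerBl => /eqP h; rewrite -[RHS]h; congr (_ *: _); ring.
move=> /eqP; rewrite scaler_eq0 (negbTE x0) orbF mulf_eq0 => /orP[|] /eqP e.
  by rewrite (_ : a = (- 1)%:~R) ?intr_int // -(addrK 1 a) e add0r rmorphN1.
rewrite (_ : a = (m%:Z - 1)%:~R) ?intr_int // rmorphB /= rmorph1.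
by apply/eqP; rewrite -subr_eq0 opprB addrA e.
Qed.

Local Open Scope classical_set_scope.

(** * Angles of nonvanishing planar fields *)

Lemma zero_itv01 (K : realType) : 0 <= (0 : K) <= 1.
Proof. by rewrite lexx /= ler01. Qed.

Lemma one_itv01 (K : realType) : 0 <= (1 : K) <= 1.
Proof. by rewrite ler01 /= lexx. Qed.

Definition clamp (K : realType) (t : K) : K := Num.max 0 (Num.min 1 t).

Lemma clamp_itv (K : realType) (t : K) : 0 <= clamp t <= 1.
Proof. by rewrite /clamp /Num.max /Num.min; do 2!case: ifP; lra. Qed.

Lemma clamp_id (K : realType) (t : K) : 0 <= t <= 1 -> clamp t = t.
Proof. by rewrite /clamp /Num.max /Num.min; do 2!case: ifP; lra. Qed.

Lemma clamp_le0 (K : realType) (t : K) : t <= 0 -> clamp t = 0.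
Proof. by rewrite /clamp /Num.max /Num.min; do 2!case: ifP; lra. Qed.

Lemma clamp_ge1 (K : realType) (t : K) : 1 <= t -> clamp t = 1.
Proof. by rewrite /clamp /Num.max /Num.min; do 2!case: ifP; lra. Qed.

Lemma clamp_continuous (K : realType) : continuous (@clamp K).
Proof.
move=> t.
apply: (@continuous_max K K (cst 0 : K -> K^o) (fun t => Num.min 1 t : K^o)).
  exact: cst_continuous.
apply: (@continuous_min K K (cst 1 : K -> K^o) (id : K -> K^o)) => //.
exact: cst_continuous.
Qed.

Definition has_angle (K : realType) (th x y : K) : Prop :=
  exists2 r, 0 < r & x = r * cos th /\ y = r * sin th.

(** The increment of angle between two vectors at less than a right angle is an
    arctangent, hence a continuous function of the two vectors. *)
Lemma has_angle_step (K : realType) (th x y x' y' : K) :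
  has_angle th x y -> 0 < x * x' + y * y' ->
  has_angle (th + atan ((x * y' - y * x') / (x * x' + y * y'))) x' y'.
Proof.
move=> [r r0 [-> ->]].
set c := cos th; set s := sin th; set w := _ / _ => dot.
have cw : 0 < cos (atan w).
  by rewrite cos_gt0_pihalf // atan_gtNpi2 atan_ltpi2.
have sw : sin (atan w) = w * cos (atan w).
  by rewrite -{2}[w]atanK /tan divfK // gt_eqF.
have cs : c ^+ 2 + s ^+ 2 = 1 by rewrite cos2Dsin2.
have D0 : 0 < c * x' + s * y'.
  by move: dot; rewrite -!mulrA -mulrDr pmulr_rgt0.
have wE : w * (c * x' + s * y') = c * y' - s * x'.
  rewrite /w -!mulrA -mulrDr -mulrBr; field; rewrite !gt_eqF //.
exists ((c * x' + s * y') / cos (atan w)); first by rewrite divr_gt0.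
rewrite cosD sinD -/c -/s sw; split.
  transitivity (c * (c * x' + s * y') - s * (w * (c * x' + s * y'))); last first.
    by field; rewrite gt_eqF.
  by rewrite wE -[LHS]mul1r -cs; ring.
transitivity (s * (c * x' + s * y') + c * (w * (c * x' + s * y'))); last first.
  by field; rewrite gt_eqF.
by rewrite wE -[LHS]mul1r -cs; ring.
Qed.

Lemma has_angle_exists (K : realType) (x y : K) :
  (x, y) <> (0, 0) -> exists th, has_angle th x y.
Proof.
wlog xge0 : x y / 0 <= x => [wl|] xy0.
  have [|xlt0] := leP 0 x; first by move=> /wl; exact.
  have Nx : 0 <= - x by lra.
  have Nxy : (- x, - y) <> (0, 0).
    by move=> [ox oy]; apply: xy0; congr pair; lra.
  have [th [r r0 [rx ry]]] := wl _ _ Nx Nxy.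
  exists (th + pi), r => //.
  by rewrite cosDpi sinDpi !mulrN -rx -ry !opprK.
have [x0|x0] := eqVneq x 0; last first.
  eexists; apply: (@has_angle_step _ 0 1 0 x y).
    by exists 1; rewrite ?ltr01 // cos0 sin0; split; lra.
  by rewrite mul1r mul0r addr0 lt_neqAle eq_sym x0.
subst x; have [y0|y0|y0] := ltgtP y 0.
- exists (- (pi / 2)), (- y); first by lra.
  by rewrite cosN sinN cos_pihalf sin_pihalf; split; lra.
- exists (pi / 2), y; first by lra.
  by rewrite cos_pihalf sin_pihalf; split; lra.
- by rewrite y0 in xy0.
Qed.

Lemma cos_sinD2piz (K : realType) (x : K) (k : int) :
  cos (x + k%:~R * (pi *+ 2)) = cos x /\ sin (x + k%:~R * (pi *+ 2)) = sin x.
Proof.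
have nat_case n (z : K) : cos (z + n%:R * (pi *+ 2)) = cos z /\
    sin (z + n%:R * (pi *+ 2)) = sin z.
  elim: n z => [|n IH] z; first by rewrite mul0r addr0.
  by rewrite -natr1 mulrDl mul1r addrA cosD2pi sinD2pi.
case: k => n; first exact: nat_case.
rewrite NegzE mulrNz mulNr; have [] := nat_case n.+1 (x - n.+1%:R * (pi *+ 2)).
by rewrite subrK => -> ->.
Qed.

Lemma cos_eq1 (K : realType) (x : K) : cos x = 1 ->
  exists k : int, x = k%:~R * (pi *+ 2).
Proof.
move=> cx.
have tp : 0 < pi *+ 2 :> K by have := @pi_gt0 K; lra.
pose k := Num.floor (x / (pi *+ 2)); exists k.
have [k1 k2] := (ge_floor (x / (pi *+ 2)), floorD1_gt (x / (pi *+ 2))).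
rewrite -/k ler_pdivlMr // in k1; rewrite -/k ltr_pdivrMr // in k2.
pose y := x - k%:~R * (pi *+ 2).
have cy : cos y = 1 by rewrite /y -mulNr -mulrNz (cos_sinD2piz x (- k)).1.
have yr : 0 <= y < pi *+ 2 by rewrite /y; move: k2; rewrite intrD; lra.
suff : y = 0 by rewrite /y => /eqP; rewrite subr_eq0 => /eqP.
have inj0 z : 0 <= z <= pi -> cos z = 1 -> z = 0.
  move=> zr cz; apply: cos_inj; rewrite ?in_itv /= ?cz ?cos0 //.
  by rewrite lexx pi_ge0.
have [yp|yp] := leP y pi; first by apply: inj0 => //; lra.
have : pi *+ 2 - y = 0.
  apply: inj0; first by lra.
  by rewrite cosB cos2pi sin2pi cy; ring.
lra.
Qed.

Lemma has_angle_inj (K : realType) (th th' x y : K) :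
  has_angle th x y -> has_angle th' x y ->
  exists k : int, th' = th + k%:~R * (pi *+ 2).
Proof.
move=> [r r0 [-> ->]] [s s0 [ex ey]].
have cs := cos2Dsin2 th; have cs' := cos2Dsin2 th'.
have rs : r = s.
  apply/eqP; rewrite -(@eqrXn2 _ 2) ?ltW //; apply/eqP.
  by rewrite -[LHS]mulr1 -[RHS]mulr1 -{1}cs -{1}cs' !mulrDr -!exprMn ex ey.
subst s; have [k kE] : exists k : int, th' - th = k%:~R * (pi *+ 2).
  apply: cos_eq1; rewrite cosB.
  by rewrite -(mulfI (lt0r_neq0 r0) ex) -(mulfI (lt0r_neq0 r0) ey) -!expr2.
by exists k; rewrite -kE addrC subrK.
Qed.

Lemma has_angleN (K : realType) (th x y : K) :
  has_angle th x y -> has_angle (th + pi) (- x) (- y).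
Proof.
by move=> [r r0 [-> ->]]; exists r => //; rewrite cosDpi sinDpi !mulrN.
Qed.

Lemma has_angleD2pi (K : realType) (th x y : K) (k : int) :
  has_angle th x y -> has_angle (th + k%:~R * (pi *+ 2)) x y.
Proof.
by move=> [r r0 [-> ->]]; exists r => //; have [-> ->] := cos_sinD2piz th k.
Qed.

Definition unit_square (K : realType) : set (K * K) := `[0, 1] `*` `[0, 1].

(** Uniform continuity in the form needed to lift angles: nearby values of a
    nonvanishing planar field on the square make an acute angle. *)
Lemma dot_uniform (K : realType) (X Y : K * K -> K) :
  continuous X -> continuous Y ->
  (forall p, unit_square p -> (X p, Y p) <> (0, 0)) ->
  exists2 e : K, 0 < e &
    forall p q, unit_square p -> ball p e q -> 0 < X p * X q + Y p * Y q.
Proof.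
move=> cX cY XY0.
have cptS : compact (@unit_square K) by apply: compact_setX; exact: segment_compact.
pose P (e : K) (p : K * K) := forall q, ball p e q -> 0 < X p * X q + Y p * Y q.
have [e [He e0]] : exists e, (@unit_square K `<=` P e) /\ 0 < e.
  apply: (@filter_ex _ (0^'+ : set_system K)).
  apply: filterI; last exact: nbhs_right_gt.
  have /compact_near_coveringP cov := cptS.
  apply: (cov K (0^'+) P _) => p Sp.
  pose D (r : (K * K) * (K * K)) := X r.1 * X r.2 + Y r.1 * Y r.2.
  have cD : continuous D.
    move=> r; have c1 (Z : K * K -> K) : continuous Z ->
        (fun r : (K * K) * (K * K) => Z r.1 * Z r.2) @ r --> Z r.1 * Z r.2.
      move=> cZ; apply: cvgM.
        by apply: (@continuous_comp _ _ _ fst Z); [exact: cvg_fst | exact: cZ].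
      by apply: (@continuous_comp _ _ _ snd Z); [exact: cvg_snd | exact: cZ].
    by apply: cvgD; exact: c1.
  have D0 : 0 < D (p, p).
    have := XY0 p Sp; rewrite /D /= -!expr2 => nz.
    rewrite lt_neqAle addr_ge0 ?sqr_ge0 // andbT eq_sym.
    apply/eqP => /eqP; rewrite paddr_eq0 ?sqr_ge0 // !sqrf_eq0.
    by move=> /andP[/eqP x0 /eqP y0]; rewrite x0 y0 in nz.
  have /= [[A B] /= [nA nB] AB] : nbhs (p, p) [set r | 0 < D r].
    exact: (cD (p, p) _ (lt_nbhsr D0)).
  have /nbhs_ballP[d /= d0 dAB] : nbhs p (A `&` B) by exact: filterI.
  exists (ball p (d / 2), [set e | e < d / 2]) => /=.
    split; first by apply: nbhsx_ballx; lra.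
    by apply: nbhs_right_lt; lra.
  move=> [q e] /= [bq ed] r br.
  apply: (AB (q, r)); split => /=.
    by apply: (dAB _ _).1; apply: le_ball bq; lra.
  apply: (dAB _ _).2; rewrite (splitr d); apply: ball_triangle bq _.
  by apply: le_ball br; exact: ltW.
by exists e => // p q Sp; exact: He.
Qed.

Lemma clamp_square (K : realType) (p : K * K) (a : K) : 0 <= a <= 1 ->
  unit_square (a * clamp p.1, a * clamp p.2).
Proof.
move=> /andP[a0 a1]; have /andP[x0 x1] := clamp_itv p.1.
have /andP[y0 y1] := clamp_itv p.2.
by split; rewrite /= in_itv /= mulr_ge0 //= mulr_ile1.
Qed.

(** The square is star-shaped about the origin, so a global angle is obtained
    without gluing: walk from 0 to p in n equal steps and add up the small
    increments of angle, each of which depends continuously on p. *)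
Lemma angle_lift (K : realType) (X Y : K * K -> K) (th0 : K) :
  continuous X -> continuous Y ->
  (forall p, unit_square p -> (X p, Y p) <> (0, 0)) ->
  has_angle th0 (X (0, 0)) (Y (0, 0)) ->
  exists th : K * K -> K, [/\ continuous th, th (0, 0) = th0 &
    forall p, unit_square p -> has_angle (th p) (X p) (Y p)].
Proof.
move=> cX cY XY0 ang0.
have [e e0 He] := dot_uniform cX cY XY0.
pose n := (Num.truncn e^-1).+1.
have n0 : 0 < n%:R :> K by rewrite ltr0n.
have ne : n%:R^-1 < e.
  by rewrite -[e]invrK ltf_pV2 ?posrE ?invr_gt0 // truncnS_gt.
(* c k p is the k-th stop of the walk. *)
pose c k (p : K * K) : K * K := (k%:R / n%:R * clamp p.1, k%:R / n%:R * clamp p.2).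
have cS k p : (k <= n)%N -> unit_square (c k p).
  move=> kn; apply: clamp_square; rewrite divr_ge0 ?ler0n //=.
  by rewrite ler_pdivrMr // mul1r ler_nat.
pose dot k p := X (c k p) * X (c k.+1 p) + Y (c k p) * Y (c k.+1 p).
pose crs k p := X (c k p) * Y (c k.+1 p) - Y (c k p) * X (c k.+1 p).
have dot0 k p : (k < n)%N -> 0 < dot k p.
  move=> kn; apply: He; first exact/cS/ltnW.
  have step t : ball (k%:R / n%:R * clamp t) e (k.+1%:R / n%:R * clamp t).
    have /andP[t0 t1] := clamp_itv t; have i0 : 0 < n%:R^-1 :> K by rewrite invr_gt0.
    rewrite /ball /= distrC.
    have -> : k.+1%:R / n%:R * clamp t - k%:R / n%:R * clamp t = n%:R^-1 * clamp t.
      by rewrite -natr1; ring.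
    rewrite ger0_norm; last by apply: mulr_ge0 => //; exact: ltW.
    by apply: le_lt_trans ne; rewrite ler_piMr // ltW.
  by split; exact: step.
pose th p := th0 + \sum_(k < n) atan (crs k p / dot k p).
have cc k : continuous (c k).
  move=> p; apply: (@cvg_pair _ _ _ (nbhs p) (nbhs _) (nbhs _)) => /=;
    apply: cvgM; try exact: cvg_cst.
    by apply: (@continuous_comp _ _ _ fst (@clamp K)); [exact: cvg_fst | exact: clamp_continuous].
  by apply: (@continuous_comp _ _ _ snd (@clamp K)); [exact: cvg_snd | exact: clamp_continuous].
have cXc k : continuous (X \o c k) by move=> p; apply: continuous_comp; [exact: cc | exact: cX].
have cYc k : continuous (Y \o c k) by move=> p; apply: continuous_comp; [exact: cc | exact: cY].
exists th; split.
- move=> p; apply: cvgD; first exact: cvg_cst.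
  apply: cvg_big => [|k _]; first exact: add_continuous.
  apply: (@continuous_comp _ _ _ (fun p => crs k p / dot k p) (@atan K)); last exact: continuous_atan.
  apply: cvgM; last first.
    apply: cvgV; first by rewrite gt_eqF // dot0.
    by apply: cvgD; apply: cvgM; [exact: cXc | exact: cXc | exact: cYc | exact: cYc].
  by apply: cvgB; apply: cvgM; [exact: cXc | exact: cYc | exact: cYc | exact: cXc].
- rewrite /th big1 ?addr0 // => k _.
  have c00 j : c j (0, 0) = (0, 0) by rewrite /c /= clamp_id ?lexx ?ler01 // mulr0.
  by rewrite /crs !c00 [Y _ * _]mulrC subrr mul0r atan0.
- move=> p Sp.
  have partial m : (m <= n)%N -> has_angle (th0 + \sum_(k < m) atan (crs k p / dot k p))
                                (X (c m p)) (Y (c m p)).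
    elim: m => [|m IH] mn.
      by rewrite big_ord0 addr0 /c !mul0r.
    rewrite big_ord_recr /= addrA; apply: has_angle_step; last exact: dot0.
    exact/IH/ltnW.
  have := partial n (leqnn n); rewrite -/(th p).
  have -> // : c n p = p.
  case: p Sp {partial} => a b [/= ]; rewrite !in_itv /= => a01 b01.
  by rewrite /c divff ?gt_eqF // !mul1r !clamp_id.
Qed.

(** [turns x y A]: the planar path (x, y), defined on the unit interval and
    avoiding the origin, turns about the origin by the total angle A. *)
Definition turns (K : realType) (x y : K -> K) (A : K) : Prop :=
  exists th : K -> K, [/\ continuous th,
    forall t, 0 <= t <= 1 -> has_angle (th t) (x t) (y t) & th 1 - th 0 = A].

Lemma turns_ext (K : realType) (x y x' y' : K -> K) (A : K) :
  (forall t, 0 <= t <= 1 -> (x t, y t) = (x' t, y' t)) ->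
  turns x y A -> turns x' y' A.
Proof.
move=> e [th [cth ath <-]]; exists th; split => // t t01.
by case: (e t t01) => <- <-; exact: ath.
Qed.

Lemma turnsN (K : realType) (x y : K -> K) (A : K) :
  turns x y A -> turns (fun t => - x t) (fun t => - y t) A.
Proof.
move=> [th [cth ath <-]]; exists (fun t => th t + pi); split.
- by move=> t; apply: cvgD; [exact: cth | exact: cvg_cst].
- by move=> t /ath; exact: has_angleN.
- by ring.
Qed.

Lemma continuous_within01 (K : realType) (f : K -> K) : continuous f ->
  {within `[0, 1], continuous f}.
Proof. by move=> cf; exact: continuous_subspaceT. Qed.

(** Two continuous angles along a path differ by a continuous function with
    values in the multiples of 2 pi, which is constant. *)
Lemma turns_uniq (K : realType) (x y : K -> K) (A A' : K) :
  turns x y A -> turns x y A' -> A = A'.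
Proof.
move=> [th [cth ath <-]] [th' [cth' ath' <-]].
pose eta t := th' t - th t.
have ceta : continuous eta by move=> t; apply: cvgB; [exact: cth' | exact: cth].
have pi0 := @pi_gt0 K.
have etaE t : 0 <= t <= 1 -> exists k : int, eta t = k%:~R * (pi *+ 2).
  move=> t01; have [k kE] := has_angle_inj (ath t t01) (ath' t t01).
  by exists k; rewrite /eta kE addrC addKr.
have [k0 k0E] := etaE 0 (ltac:(by rewrite lexx ler01)).
have [k1 k1E] := etaE 1 (ltac:(by rewrite lexx ler01)).
suff k01 : k0 = k1 by move: k0E k1E; rewrite k01 /eta; lra.
apply/eqP; apply/negPn/negP => k01.
(* Half-way between two consecutive multiples of 2 pi. *)
pose v : K := (Num.min k0 k1)%:~R * (pi *+ 2) + pi.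
have [|t t01 tE] := @IVT K eta 0 1 v ler01 (continuous_within01 ceta).
  rewrite k0E k1E /v; case: (ltgtP k0 k1) k01 => // lt01 _.
  - have h : (k0 + 1)%:~R <= k1%:~R :> K by rewrite ler_int; lia.
    have h' : (k0%:~R + 1) * pi <= k1%:~R * pi :> K.
      by rewrite ler_wpM2r ?(ltW pi0) // -intrD1.
    by rewrite /Num.min /Num.max; case: ifP; lra.
  - have h : (k1 + 1)%:~R <= k0%:~R :> K by rewrite ler_int; lia.
    have h' : (k1%:~R + 1) * pi <= k0%:~R * pi :> K.
      by rewrite ler_wpM2r ?(ltW pi0) // -intrD1.
    by rewrite /Num.min /Num.max; case: ifP; lra.
have [k kE] := etaE t t01; move: tE; rewrite kE /v => tE.
have /(mulIf (lt0r_neq0 pi0)) : (k%:~R * 2) * pi = ((Num.min k0 k1)%:~R * 2 + 1) * pi :> K.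
  by lra.
move=> e; have : (k * 2)%:~R = ((Num.min k0 k1) * 2 + 1)%:~R :> K.
  by rewrite intrD !intrM.
by move=> /intr_inj; lia.
Qed.

Lemma continuous_pair_comp (K : realType) (Z : K * K -> K) (f g : K -> K) :
  continuous Z -> continuous f -> continuous g ->
  continuous (fun t => Z (f t, g t)).
Proof.
move=> cZ cf cg t; apply: (@continuous_comp _ _ _ (fun t => (f t, g t)) Z); last exact: cZ.
by apply: (@cvg_pair _ _ _ (nbhs t) (nbhs _) (nbhs _)); [exact: cf | exact: cg].
Qed.

(** A nonvanishing field has total turning zero around the square: this is the
    only topological input of the nonplanarity of K5 below. *)
Lemma turns_square (K : realType) (X Y : K * K -> K) :
  continuous X -> continuous Y ->
  (forall p, unit_square p -> (X p, Y p) <> (0, 0)) ->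
  exists A0 A1 B0 B1, [/\
    turns (fun s => X (s, 0)) (fun s => Y (s, 0)) A0,
    turns (fun s => X (s, 1)) (fun s => Y (s, 1)) A1,
    turns (fun t => X (0, t)) (fun t => Y (0, t)) B0,
    turns (fun t => X (1, t)) (fun t => Y (1, t)) B1
  & A0 + B1 = B0 + A1].
Proof.
move=> cX cY XY0.
have S01 (s t : K) : 0 <= s <= 1 -> 0 <= t <= 1 -> unit_square (s, t).
  by move=> s01 t01; split; rewrite /= in_itv.
have i0 := @zero_itv01 K.
have i1 := @one_itv01 K.
have [th0 ath0] := has_angle_exists (XY0 _ (S01 0 0 i0 i0)).
have [th [cth _ ath]] := angle_lift cX cY XY0 ath0.
have cl c : continuous (fun t => th (t, c)).
  by apply: continuous_pair_comp => // t; [exact: cvg_id | exact: cvg_cst].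
have cr c : continuous (fun t => th (c, t)).
  by apply: continuous_pair_comp => // t; [exact: cvg_cst | exact: cvg_id].
exists (th (1, 0) - th (0, 0)), (th (1, 1) - th (0, 1)),
  (th (0, 1) - th (0, 0)), (th (1, 1) - th (1, 0)); split; last by ring.
- by exists (fun s => th (s, 0)); split => // t t01; exact/ath/S01.
- by exists (fun s => th (s, 1)); split => // t t01; exact/ath/S01.
- by exists (fun s => th (0, s)); split => // t t01; exact/ath/S01.
- by exists (fun s => th (1, s)); split => // t t01; exact/ath/S01.
Qed.

Lemma path_lift (K : realType) (x y : K -> K) (th0 : K) :
  continuous x -> continuous y ->
  (forall t, 0 <= t <= 1 -> (x t, y t) <> (0, 0)) ->
  has_angle th0 (x 0) (y 0) ->
  exists th : K -> K, [/\ continuous th, th 0 = th0 &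
    forall t, 0 <= t <= 1 -> has_angle (th t) (x t) (y t)].
Proof.
move=> cx cy xy0 ath0.
have cf (z : K -> K) : continuous z -> continuous (fun p : K * K => z p.1).
  by move=> cz p; apply: (@continuous_comp _ _ _ fst z); [exact: cvg_fst | exact: cz].
have [|th [cth th00 ath]] := @angle_lift K (fun p => x p.1) (fun p => y p.1) th0
    (cf x cx) (cf y cy) _ ath0.
  by move=> [s t] [/= s01 _]; apply: xy0; rewrite in_itv /= in s01.
exists (fun t => th (t, 0)); split => //.
  by apply: continuous_pair_comp => // t; [exact: cvg_id | exact: cvg_cst].
move=> t t01; apply: (ath (t, 0)); split; rewrite /= in_itv //=.
by rewrite lexx ?ler01.
Qed.

Lemma turns_exists (K : realType) (x y : K -> K) :
  continuous x -> continuous y ->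
  (forall t, 0 <= t <= 1 -> (x t, y t) <> (0, 0)) -> exists A, turns x y A.
Proof.
move=> cx cy xy0; have i0 := @zero_itv01 K.
have [th0 ath0] := has_angle_exists (xy0 0 i0).
have [th [cth _ ath]] := path_lift cx cy xy0 ath0.
by exists (th 1 - th 0), th.
Qed.

Lemma turns_mod2pi (K : realType) (x y : K -> K) (A th0 th1 : K) :
  turns x y A -> has_angle th0 (x 0) (y 0) -> has_angle th1 (x 1) (y 1) ->
  exists k : int, A = th1 - th0 + k%:~R * (pi *+ 2).
Proof.
move=> [th [cth ath <-]] a0 a1.
have i0 := @zero_itv01 K.
have i1 := @one_itv01 K.
have [k0 ->] := has_angle_inj a0 (ath 0 i0).
have [k1 ->] := has_angle_inj a1 (ath 1 i1).
by exists (k1 - k0); rewrite intrB; ring.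
Qed.

(** * K5 is not planar *)

(** Edges are indexed by pairs a < b, and only edges without a common endpoint
    have to be disjoint; two edges at the same vertex may meet anywhere. *)
Definition K5_drawing (K : realType) (P : Type)
    (pt : 'I_5 -> P) (arc : 'I_5 -> 'I_5 -> K -> P) : Prop :=
  (forall a b : 'I_5, (a < b)%N -> arc a b 0 = pt a /\ arc a b 1 = pt b) /\
  (forall a b c d : 'I_5, (a < b)%N -> (c < d)%N -> uniq [:: a; b; c; d] ->
     forall s t : K, 0 <= s <= 1 -> 0 <= t <= 1 -> arc a b s <> arc c d t).

Lemma fresh_vertex (a b c : 'I_5) : exists w, w \notin [:: a; b; c].
Proof.
case: (pickP (fun w => w \notin [:: a; b; c])) => [w wP|all]; first by exists w.
have : (size (enum 'I_5) <= size [:: a; b; c])%N.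
  apply: uniq_leq_size (enum_uniq _) _ => w _.
  by move/negbT: (all w); rewrite negbK.
by rewrite size_enum_ord.
Qed.

(** A vertex v off the edge ab is an end of some edge disjoint from ab, because
    there is a fourth vertex to join it to. *)
Lemma K5_drawing_vertex (K : realType) (P : Type)
    (pt : 'I_5 -> P) (arc : 'I_5 -> 'I_5 -> K -> P) (a b v : 'I_5) (t : K) :
  K5_drawing pt arc -> (a < b)%N -> v != a -> v != b -> 0 <= t <= 1 ->
  arc a b t <> pt v.
Proof.
move=> [ends dis] ab va vb t01.
have [w] := fresh_vertex a b v; rewrite !inE !negb_or => /and3P[wa wb wv].
have ab' : a != b by apply: contraTneq ab => ->; rewrite ltnn.
have [wltv|vltw|/val_inj wEv] := ltngtP w v; last by rewrite wEv eqxx in wv.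
- have [_ <-] := ends _ _ wltv; apply: dis => //; last exact: one_itv01.
  by move: ab' va vb wa wb wv; rewrite /= !inE -!val_eqE /=; lia.
- have [<- _] := ends _ _ vltw; apply: dis => //; last exact: zero_itv01.
  by move: ab' va vb wa wb wv; rewrite /= !inE -!val_eqE /=; lia.
Qed.

Lemma K5_drawing_pt_neq (K : realType) (P : Type)
    (pt : 'I_5 -> P) (arc : 'I_5 -> 'I_5 -> K -> P) (a b : 'I_5) :
  K5_drawing pt arc -> a != b -> pt a <> pt b.
Proof.
move=> dr ab; have [w] := fresh_vertex a a b.
rewrite !inE !negb_or => /and3P[wa _ wb]; have [ends _] := dr.
have ba : b != a by rewrite eq_sym.
have bw : b != w by rewrite eq_sym.
have [wlta|altw|/val_inj wEa] := ltngtP w a; last by rewrite wEa eqxx in wa.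
- have [_ <-] := ends _ _ wlta.
  by apply: K5_drawing_vertex dr _ _ _ (one_itv01 K).
- have [<- _] := ends _ _ altw.
  by apply: K5_drawing_vertex dr _ _ _ (zero_itv01 K).
Qed.

(** For disjoint edges ab and cd the difference of their points is a
    nonvanishing field on the square, so its turning around the boundary is
    zero. The four sides are the turnings of one edge seen from an end of the
    other, known modulo 2 pi from the directions between vertices; let k be the
    integers that remain. For each of the 15 pairs of disjoint edges one gets a
    relation between four integers k, whose constant term is odd exactly when
    the pairs ab and cd interleave. Every k occurs in two relations and 5 pairs
    of edges interleave, so the sum of the relations says that 5 is even. *)
Theorem K5_nonplanar (K : realType)
    (pt : 'I_5 -> K * K) (arc : 'I_5 -> 'I_5 -> K -> K * K) :
  (forall a b : 'I_5, (a < b)%N -> continuous (fun t => (arc a b t).1)) ->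
  (forall a b : 'I_5, (a < b)%N -> continuous (fun t => (arc a b t).2)) ->
  ~ K5_drawing pt arc.
Proof.
move=> cx cy dr; have [ends dis] := dr.
have pi0 := @pi_gt0 K.
(* The angle of a direction determines that of the opposite one, so that only
   the order of the vertices enters the constants of the relations. *)
have [th [ath thN]] : exists th : 'I_5 -> 'I_5 -> K,
    (forall a b : 'I_5, a != b -> has_angle (th a b) ((pt b).1 - (pt a).1) ((pt b).2 - (pt a).2)) /\
    (forall a b : 'I_5, (a < b)%N -> th b a = th a b + pi).
  have /choice[f fP] : forall ab : 'I_5 * 'I_5, exists th, ab.1 != ab.2 ->
      has_angle th ((pt ab.2).1 - (pt ab.1).1) ((pt ab.2).2 - (pt ab.1).2).
    move=> [a b] /=; have [->|ab] := eqVneq a b; first by exists 0.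
    have [|th ath] := @has_angle_exists K ((pt b).1 - (pt a).1) ((pt b).2 - (pt a).2).
      move=> [/eqP]; rewrite subr_eq0 => /eqP e1 /eqP; rewrite subr_eq0 => /eqP e2.
      apply: (K5_drawing_pt_neq dr ab).
      by case: (pt a) (pt b) e1 e2 => [? ?] [? ?] /= -> ->.
    by exists th.
  exists (fun a b : 'I_5 => if (a < b)%N then f (a, b) else f (b, a) + pi); split.
    move=> a b ab; have [ltab|ltba|/val_inj e] := ltngtP a b.
    - exact: (fP (a, b)).
    - rewrite -[_ - (pt a).1]opprB -[_ - (pt a).2]opprB; apply: has_angleN.
      by apply: (fP (b, a)); rewrite eq_sym.
    - by rewrite e eqxx in ab.
  by move=> a b ab; rewrite ab ltnNge (ltnW ab).
have ab_neq (a b : 'I_5) : (a < b)%N -> a != b.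
  by apply: contraTneq => ->; rewrite ltnn.
have [k kP] : exists k : 'I_5 -> 'I_5 -> 'I_5 -> int, forall (a b v : 'I_5) A,
    (a < b)%N -> v != a -> v != b ->
    turns (fun t => (arc a b t).1 - (pt v).1) (fun t => (arc a b t).2 - (pt v).2) A ->
    A = th v b - th v a + (k a b v)%:~R * (pi *+ 2).
  have /choice[f fP] : forall abv : 'I_5 * 'I_5 * 'I_5, exists k : int,
      let: (a, b, v) := abv in forall A, (a < b)%N -> v != a -> v != b ->
      turns (fun t => (arc a b t).1 - (pt v).1) (fun t => (arc a b t).2 - (pt v).2) A ->
      A = th v b - th v a + k%:~R * (pi *+ 2).
    move=> [[a b] v].
    have [ltab|] := boolP (a < b)%N; last by exists 0.
    have [|va] := boolP (v == a); first by exists 0.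
    have [|vb] := boolP (v == b); first by exists 0.
    have [|||A tA] := @turns_exists K
        (fun t => (arc a b t).1 - (pt v).1) (fun t => (arc a b t).2 - (pt v).2).
    - by move=> t; apply: cvgB; [exact: cx | exact: cvg_cst].
    - by move=> t; apply: cvgB; [exact: cy | exact: cvg_cst].
    - move=> t t01 [/eqP]; rewrite subr_eq0 => /eqP e1 /eqP; rewrite subr_eq0 => /eqP e2.
      apply: (K5_drawing_vertex dr ltab va vb t01).
      by case: (arc a b t) (pt v) e1 e2 => [? ?] [? ?] /= -> ->.
    have [ea eb] := ends _ _ ltab.
    have [||k kE] := turns_mod2pi (th0 := th v a) (th1 := th v b) tA.
    - by rewrite ea; exact: ath.
    - by rewrite eb; exact: ath.
    by exists k => A' _ _ _ /(turns_uniq tA) <-.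
  by exists (fun a b v => f (a, b, v)) => a b v A; exact: (fP (a, b, v)).
have square (a b c d : 'I_5) : (a < b)%N -> (c < d)%N -> uniq [:: a; b; c; d] ->
    (th c b - th b c) - (th c a - th a c) + (th b d - th d b) - (th a d - th d a)
    = (k c d a + k a b d - k a b c - k c d b)%:~R * (pi *+ 2).
  move=> ab cd; have un := dis a b c d ab cd; move=> /[dup] /un {}un.
  rewrite /= !inE !negb_or => /and4P[/and3P[_ ac ad] /andP[bc bd] _ _].
  pose X (p : K * K) := (arc a b p.1).1 - (arc c d p.2).1.
  pose Y (p : K * K) := (arc a b p.1).2 - (arc c d p.2).2.
  have cX : continuous X.
    move=> p; apply: cvgB.
      by apply: (@continuous_comp _ _ _ fst (fun t => (arc a b t).1)); [exact: cvg_fst | exact: cx].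
    by apply: (@continuous_comp _ _ _ snd (fun t => (arc c d t).1)); [exact: cvg_snd | exact: cx].
  have cY : continuous Y.
    move=> p; apply: cvgB.
      by apply: (@continuous_comp _ _ _ fst (fun t => (arc a b t).2)); [exact: cvg_fst | exact: cy].
    by apply: (@continuous_comp _ _ _ snd (fun t => (arc c d t).2)); [exact: cvg_snd | exact: cy].
  have XY0 p : unit_square p -> (X p, Y p) <> (0, 0).
    case: p => s t [/= s01 t01] [/eqP]; rewrite !in_itv /= in s01 t01.
    rewrite subr_eq0 => /eqP e1 /eqP; rewrite subr_eq0 => /eqP e2.
    apply: (un s t s01 t01).
    by case: (arc a b s) (arc c d t) e1 e2 => [? ?] [? ?] /= -> ->.
  have [A0 [A1 [B0 [B1 [tA0 tA1 tB0 tB1 e]]]]] := turns_square cX cY XY0.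
  have [ea eb] := ends _ _ ab; have [ec ed] := ends _ _ cd.
  have {}tA0 : A0 = th c b - th c a + (k a b c)%:~R * (pi *+ 2).
    apply: kP; rewrite // 1?eq_sym //.
    by apply: turns_ext tA0 => t _; rewrite /X /Y /= ec.
  have {}tA1 : A1 = th d b - th d a + (k a b d)%:~R * (pi *+ 2).
    apply: kP; rewrite // 1?eq_sym //.
    by apply: turns_ext tA1 => t _; rewrite /X /Y /= ed.
  have {}tB0 : B0 = th a d - th a c + (k c d a)%:~R * (pi *+ 2).
    apply: kP => //.
    by apply: turns_ext (turnsN tB0) => t _; rewrite /X /Y /= ea !opprB.
  have {}tB1 : B1 = th b d - th b c + (k c d b)%:~R * (pi *+ 2).
    apply: kP => //.
    by apply: turns_ext (turnsN tB1) => t _; rewrite /X /Y /= eb !opprB.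
  by move: e; rewrite tA0 tA1 tB0 tB1 !intrB intrD; lra.
have parity (a b c d : 'I_5) : (a < b)%N -> (c < d)%N -> (a < c)%N -> (b != c) && (b != d) ->
    k c d a + k a b d - k a b c - k c d b = - ((c < b < d)%N)%:Z.
  move=> ab cd ac /andP[bc bd].
  have ad : (a < d)%N by apply: ltn_trans cd.
  have un : uniq [:: a; b; c; d].
    by rewrite /= !inE !negb_or bc bd !ab_neq.
  have := square a b c d ab cd un; rewrite (thN a c ac) (thN a d ad).
  have [ltbc|ltcb|/val_inj e] := ltngtP b c; last by rewrite e eqxx in bc.
  - rewrite (thN b c) // (thN b d); last exact: ltn_trans cd.
    move=> e; apply: (@intr_inj K); apply: (mulIf (lt0r_neq0 pi0)).
    by rewrite /= oppr0 mul0r; lra.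
  rewrite (thN c b) //.
  have [ltbd|ltdb|/val_inj e] := ltngtP b d; last by rewrite e eqxx in bd.
  - rewrite (thN b d) // => e; apply: (@intr_inj K); apply: (mulIf (lt0r_neq0 pi0)).
    by rewrite /= intrN; lra.
  - rewrite (thN d b) // => e; apply: (@intr_inj K); apply: (mulIf (lt0r_neq0 pi0)).
    by rewrite /= oppr0 mul0r; lra.
(* The 15 relations, which are inconsistent modulo 2. *)
pose v i : 'I_5 := inord i.
have par (i j l m : nat) : (i < j < 5)%N -> (l < m < 5)%N -> (i < l)%N ->
    (j != l) && (j != m) ->
    k (v l) (v m) (v i) + k (v i) (v j) (v m) - k (v i) (v j) (v l) - k (v l) (v m) (v j)
    = - ((l < j < m)%N)%:Z.
  move=> /andP[ij j5] /andP[lm m5] il jn.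
  have [vi vj vl vm] : [/\ v i = i :> nat, v j = j :> nat, v l = l :> nat & v m = m :> nat].
    by split; rewrite inordK //; lia.
  by rewrite parity ?vi ?vj ?vl ?vm // -!val_eqE /= vj vl vm.
have := par 0 1 2 3 isT isT isT isT; have := par 0 1 2 4 isT isT isT isT.
have := par 0 1 3 4 isT isT isT isT; have := par 0 2 1 3 isT isT isT isT.
have := par 0 2 1 4 isT isT isT isT; have := par 0 2 3 4 isT isT isT isT.
have := par 0 3 1 2 isT isT isT isT; have := par 0 3 1 4 isT isT isT isT.
have := par 0 3 2 4 isT isT isT isT; have := par 0 4 1 2 isT isT isT isT.
have := par 0 4 1 3 isT isT isT isT; have := par 0 4 2 3 isT isT isT isT.
have := par 1 2 3 4 isT isT isT isT; have := par 1 3 2 4 isT isT isT isT.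
have := par 1 4 2 3 isT isT isT isT.
rewrite /=; lia.
Qed.

(** * K5 in the punctured sphere *)

Lemma K5_drawing_map (K : realType) (P Q : Type) (phi : P -> Q)
    (pt : 'I_5 -> P) (arc : 'I_5 -> 'I_5 -> K -> P) :
  (forall (a b c d : 'I_5) s t, (a < b)%N -> (c < d)%N ->
     phi (arc a b s) = phi (arc c d t) -> arc a b s = arc c d t) ->
  K5_drawing pt arc ->
  K5_drawing (phi \o pt) (fun a b => phi \o arc a b).
Proof.
move=> inj [ends dis]; split => [a b ab|a b c d ab cd un s t s01 t01].
  by rewrite /=; have [-> ->] := ends a b ab.
by move=> /inj e; apply: (dis a b c d ab cd un s t s01 t01); exact: e.
Qed.

Definition coord_continuous (K : realType) (f : K -> K * K * K) : Prop :=
  [/\ continuous (fun t => (f t).1.1), continuous (fun t => (f t).1.2)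
    & continuous (fun t => (f t).2)].

Definition dot3 (K : realType) (p q : K * K * K) : K :=
  p.1.1 * q.1.1 + p.1.2 * q.1.2 + p.2 * q.2.

Lemma dot3_neq1 (K : realType) (p q : K * K * K) :
  dot3 p p = 1 -> dot3 q q = 1 -> q <> p -> 1 - dot3 q p != 0.
Proof.
case: p q => [[a b] c] [[x y] z]; rewrite /dot3 /= => p1 q1 qp.
apply/eqP => d0; apply: qp.
have : (x - a) ^+ 2 + (y - b) ^+ 2 + (z - c) ^+ 2 == 0 by apply/eqP; lra.
rewrite !paddr_eq0 ?addr_ge0 ?sqr_ge0 // !sqrf_eq0 !subr_eq0.
by move=> /andP[/andP[/eqP -> /eqP ->] /eqP ->].
Qed.

(** Stereographic projection from p, in the coordinates (c x - a z, c y - b z)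
    for p = (a, b, c): they vanish at p and are coordinates on the plane
    orthogonal to p when c is nonzero. *)
Definition stereographic (K : realType) (p q : K * K * K) : K * K :=
  ((p.2 * q.1.1 - p.1.1 * q.2) / (1 - dot3 q p),
   (p.2 * q.1.2 - p.1.2 * q.2) / (1 - dot3 q p)).

(** Equal images put q - p and q' - p on the same ray, and a ray from p meets
    the sphere only once more. *)
Lemma stereographic_inj (K : realType) (p q q' : K * K * K) :
  p.2 != 0 -> dot3 p p = 1 -> dot3 q q = 1 -> dot3 q' q' = 1 ->
  q <> p -> q' <> p -> stereographic p q = stereographic p q' -> q = q'.
Proof.
move=> c0 p1 q1 q1' qp qp'.
have D0 := dot3_neq1 p1 q1 qp; have D0' := dot3_neq1 p1 q1' qp'.
case: p q q' c0 p1 q1 q1' {qp qp'} D0 D0' => [[a b] c] [[x y] z] [[x' y'] z'].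
rewrite /stereographic /dot3 /=; set D := 1 - _; set D' := 1 - _.
move=> c0 p1 q1 q1' D0 D0' [e1 e2].
(* The ratio of q - p to q' - p. *)
pose l := D / D'.
have {}e1 : c * x - a * z = l * (c * x' - a * z').
  by rewrite /l mulrAC -mulrA -e1; field.
have {}e2 : c * y - b * z = l * (c * y' - b * z').
  by rewrite /l mulrAC -mulrA -e2; field.
have e3 : D = l * D' by rewrite /l divfK.
have ez : z - c = l * (z' - c).
  suff : (z - c) - l * (z' - c) = 0 by move/eqP; rewrite subr_eq0 => /eqP.
  rewrite -[LHS]mul1r -p1.
  transitivity (c * (a * x + b * y + c * z - 1 - l * (a * x' + b * y' + c * z' - 1))
     - a * (c * x - a * z - l * (c * x' - a * z'))
     - b * (c * y - b * z - l * (c * y' - b * z'))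
     + (c - l * c) * (1 - (a * a + b * b + c * c))).
    by ring.
  rewrite e1 e2 p1 !subrr !mulr0 !subr0 addr0.
  by move: e3; rewrite /D /D' => e3; apply/eqP; rewrite mulf_eq0 (negbTE c0) /=; lra.
have ex : x - a = l * (x' - a).
  by apply: (mulfI c0); nra.
have ey : y - b = l * (y' - b).
  by apply: (mulfI c0); nra.
have l1 : l = 1.
  have l0 : l != 0 by rewrite /l mulf_neq0 ?invr_eq0.
  have w : (x - a) ^+ 2 + (y - b) ^+ 2 + (z - c) ^+ 2 = 2 * D by rewrite /D; lra.
  have w' : (x' - a) ^+ 2 + (y' - b) ^+ 2 + (z' - c) ^+ 2 = 2 * D' by rewrite /D'; lra.
  apply: (mulfI l0); apply: (mulIf D0').
  rewrite mulr1 -e3.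
  have : l ^+ 2 * (2 * D') = 2 * D.
    by rewrite -w' -w ex ey ez; ring.
  by lra.
by move: ex ey ez; rewrite l1 !mul1r => /addIr -> /addIr -> /addIr ->.
Qed.

Lemma K5_punctured_sphere_wlog (K : realType) (p : K * K * K)
    (pt : 'I_5 -> K * K * K) (arc : 'I_5 -> 'I_5 -> K -> K * K * K) :
  p.2 != 0 -> dot3 p p = 1 ->
  (forall a b : 'I_5, (a < b)%N -> coord_continuous (arc a b)) ->
  (forall (a b : 'I_5) t, (a < b)%N -> dot3 (arc a b t) (arc a b t) = 1) ->
  (forall (a b : 'I_5) t, (a < b)%N -> arc a b t <> p) ->
  ~ K5_drawing pt arc.
Proof.
move=> c0 p1 carc arc1 arcp dr.
apply: (@K5_nonplanar K (stereographic p \o pt)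
  (fun a b => stereographic p \o arc a b)); last first.
- apply: K5_drawing_map dr => a b c d s t ab cd; apply: stereographic_inj => //;
    by [exact: arc1 | exact: arcp].
- move=> a b ab t; have [cx cy cz] := carc a b ab.
  apply: cvgM.
    by apply: cvgB; apply: cvgM; try exact: cvg_cst; [exact: cy | exact: cz].
  apply: cvgV; first by apply: dot3_neq1; [ | exact: arc1 | exact: arcp].
  apply: cvgB; first exact: cvg_cst.
  apply: cvgD; last by apply: cvgM; [exact: cz | exact: cvg_cst].
  by apply: cvgD; apply: cvgM; try exact: cvg_cst; [exact: cx | exact: cy].
- move=> a b ab t; have [cx cy cz] := carc a b ab.
  apply: cvgM.
    by apply: cvgB; apply: cvgM; try exact: cvg_cst; [exact: cx | exact: cz].
  apply: cvgV; first by apply: dot3_neq1; [ | exact: arc1 | exact: arcp].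
  apply: cvgB; first exact: cvg_cst.
  apply: cvgD; last by apply: cvgM; [exact: cz | exact: cvg_cst].
  by apply: cvgD; apply: cvgM; try exact: cvg_cst; [exact: cx | exact: cy].
Qed.

(** Some coordinate of p is nonzero; rotating the coordinates makes it the last
    one. *)
Theorem K5_punctured_sphere (K : realType) (p : K * K * K)
    (pt : 'I_5 -> K * K * K) (arc : 'I_5 -> 'I_5 -> K -> K * K * K) :
  dot3 p p = 1 ->
  (forall a b : 'I_5, (a < b)%N -> coord_continuous (arc a b)) ->
  (forall (a b : 'I_5) t, (a < b)%N -> dot3 (arc a b t) (arc a b t) = 1) ->
  (forall (a b : 'I_5) t, (a < b)%N -> arc a b t <> p) ->
  ~ K5_drawing pt arc.
Proof.
move=> p1 carc arc1 arcp dr.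
pose rot (q : K * K * K) : K * K * K := (q.1.2, q.2, q.1.1).
have rot_inj q q' : rot q = rot q' -> q = q'.
  by case: q q' => [[? ?] ?] [[? ?] ?] [-> -> ->].
have dot_rot q : dot3 (rot q) (rot q) = dot3 q q.
  by case: q => [[? ?] ?]; rewrite /dot3 /=; ring.
have rotate q : rot q <> rot p -> q <> p by move=> h e; apply: h; rewrite e.
have [c0|c0] := eqVneq p.2 0; last first.
  exact: (K5_punctured_sphere_wlog c0 p1 carc arc1 arcp dr).
have [a0|a0] := eqVneq p.1.1 0; last first.
  apply: (@K5_punctured_sphere_wlog K (rot p) (rot \o pt) (fun a b => rot \o arc a b)).
  - by [].
  - by rewrite dot_rot.
  - by move=> a b ab; have [cx cy cz] := carc a b ab.
  - by move=> a b t ab; rewrite /= dot_rot; exact: arc1.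
  - by move=> a b t ab /= /rot_inj; exact: arcp.
  - by apply: K5_drawing_map dr => *; exact: rot_inj.
have [b0|b0] := eqVneq p.1.2 0.
  by move: p1; rewrite /dot3 a0 b0 c0 !mulr0 !addr0 => /esym/eqP; rewrite oner_eq0.
apply: (@K5_punctured_sphere_wlog K (rot (rot p)) (rot \o rot \o pt)
  (fun a b => rot \o rot \o arc a b)).
- by [].
- by rewrite !dot_rot.
- by move=> a b ab; have [cx cy cz] := carc a b ab.
- by move=> a b t ab; rewrite /= !dot_rot; exact: arc1.
- by move=> a b t ab /= /rot_inj/rot_inj; exact: arcp.
- by apply: K5_drawing_map dr => ? ? ? ? ? ? _ _ /rot_inj; exact: rot_inj.
Qed.

(** * Loops on the torus *)

Lemma turns_conj (K : realType) (x y : K -> K) (A : K) :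
  turns x y A -> turns x (fun t => - y t) (- A).
Proof.
move=> [th [cth ath <-]]; exists (fun t => - th t); split.
- by move=> t; apply: cvgN; exact: cth.
- move=> t /ath[r r0 [-> ->]]; exists r => //.
  by rewrite cosN sinN mulrN.
- by ring.
Qed.

Lemma turns_swap (K : realType) (x y : K -> K) (A : K) :
  turns x y A -> turns y x (- A).
Proof.
move=> [th [cth ath <-]]; exists (fun t => - th t + pi / 2); split.
- by move=> t; apply: cvgD; [apply: cvgN; exact: cth | exact: cvg_cst].
- move=> t /ath[r r0 [-> ->]]; exists r => //.
  by rewrite cosDpihalf sinDpihalf cosN sinN opprK.
- by ring.
Qed.

(** A path that stays in the upper half-plane keeps its angle between two
    consecutive multiples of pi, where the cosine decreases. *)
Lemma turns_upper_lt0 (K : realType) (x y : K -> K) (A : K) :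
  (forall t, 0 <= t <= 1 -> 0 < y t) -> x 0 < 0 -> 0 < x 1 ->
  turns x y A -> A < 0.
Proof.
move=> y0 xn xp [th [cth ath <-]].
have pi0 := @pi_gt0 K.
have sinth t : 0 <= t <= 1 -> 0 < sin (th t).
  move=> t01; have [r r0 [_ yE]] := ath t t01.
  by have := y0 t t01; rewrite yE pmulr_rgt0.
have cosn : cos (th 0) < 0.
  by have [r r0 [xE _]] := ath 0 (zero_itv01 K); move: xn; rewrite xE pmulr_rlt0.
have cosp : 0 < cos (th 1).
  by have [r r0 [xE _]] := ath 1 (one_itv01 K); move: xp; rewrite xE pmulr_rgt0.
pose k := Num.floor (th 0 / (pi *+ 2)).
have tp : 0 < pi *+ 2 :> K by lra.
have [k1 k2] := (ge_floor (th 0 / (pi *+ 2)), floorD1_gt (th 0 / (pi *+ 2))).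
rewrite -/k ler_pdivlMr // in k1; rewrite -/k ltr_pdivrMr // intrD mulrDl mul1r in k2.
pose eta t := th t + (- k)%:~R * (pi *+ 2).
have trig t : cos (eta t) = cos (th t) /\ sin (eta t) = sin (th t).
  exact: cos_sinD2piz.
have ceta : continuous eta by move=> t; apply: cvgD; [exact: cth | exact: cvg_cst].
have eta0 : 0 < eta 0 < pi.
  have e0 : 0 <= eta 0 < pi *+ 2 by rewrite /eta mulrNz mulNr; lra.
  have s0 : 0 < sin (eta 0) by rewrite (trig 0).2 sinth ?zero_itv01.
  apply/andP; split.
    rewrite lt_neqAle; have /andP[-> _] := e0; rewrite andbT eq_sym.
    by apply: contraTneq s0 => ->; rewrite sin0 ltxx.
  rewrite ltNge; apply/negP => pe.
  have := @sin_ge0_pi K (eta 0 - pi) (ltac:(lra)).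
  by rewrite sinB cospi sinpi; lra.
have eta1 : 0 < eta 1 < pi.
  have stay v : sin v = 0 -> ~ (Num.min (eta 0) (eta 1) <= v <= Num.max (eta 0) (eta 1)).
    move=> sv /(IVT ler01 (continuous_within01 ceta))[t t01 tE].
    rewrite in_itv /= in t01; have := sinth t t01.
    by rewrite -(trig t).2 tE sv ltxx.
  apply/andP; split; rewrite ltNge; apply/negP => h.
    by apply: (stay 0); rewrite ?sin0 // /Num.min /Num.max; case: ifP; lra.
  by apply: (stay pi); rewrite ?sinpi // /Num.min /Num.max; case: ifP; lra.
have : eta 1 < eta 0.
  rewrite -(@ltr_cos K); rewrite ?in_itv /=; try lra.
  by rewrite (trig 0).1 (trig 1).1; lra.
by rewrite /eta; lra.
Qed.

(** The two-dimensional intermediate value theorem: otherwise the field (X, Y)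
    would turn positively along the path of the square through the corner (1,
    0), and negatively along the path through (0, 1). *)
Theorem poincare_miranda (K : realType) (X Y : K * K -> K) :
  continuous X -> continuous Y ->
  (forall t, 0 <= t <= 1 -> X (0, t) < 0 < X (1, t)) ->
  (forall s, 0 <= s <= 1 -> Y (s, 0) < 0 < Y (s, 1)) ->
  exists p, unit_square p /\ (X p, Y p) = (0, 0).
Proof.
move=> cX cY X01 Y01; apply: contrapT => noz.
have i0 := zero_itv01 K; have i1 := one_itv01 K.
have [|A0 [A1 [B0 [B1 [tA0 tA1 tB0 tB1 e]]]]] := turns_square cX cY.
  by move=> p Sp pz; apply: noz; exists p.
have A0p : - A0 < 0.
  apply: turns_upper_lt0 (turns_conj tA0) => [t t01||].
  - by have /andP[? _] := Y01 t t01; lra.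
  - by have /andP[] := X01 0 i0.
  - by have /andP[] := X01 0 i0.
have A1n : A1 < 0.
  apply: turns_upper_lt0 tA1 => [t t01||].
  - by have /andP[? ?] := Y01 t t01; lra.
  - by have /andP[] := X01 1 i1.
  - by have /andP[] := X01 1 i1.
have B0n : - - B0 < 0.
  apply: turns_upper_lt0 (turns_conj (turns_swap tB0)) => [t t01||].
  - by have /andP[? _] := X01 t t01; lra.
  - by have /andP[] := Y01 0 i0.
  - by have /andP[] := Y01 0 i0.
have B1p : - B1 < 0.
  apply: turns_upper_lt0 (turns_swap tB1) => [t t01||].
  - by have /andP[? ?] := X01 t t01; lra.
  - by have /andP[] := Y01 1 i1.
  - by have /andP[] := Y01 1 i1.
lra.
Qed.

(** The path of length N that follows N translates of f, each starting where the
    previous one ends; written as a sum so that its continuity is immediate. *)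
Definition iterate_path (K : realType) (N : nat) (f : K -> K) (s : K) : K :=
  f 0 + \sum_(j < N) (f (clamp (s - j%:R)) - f 0).

Lemma iterate_path_continuous (K : realType) (N : nat) (f : K -> K) :
  continuous f -> continuous (iterate_path N f).
Proof.
move=> cf s; apply: cvgD; first exact: cvg_cst.
apply: cvg_big => [|j _]; first exact: add_continuous.
apply: cvgB; last exact: cvg_cst.
have csh : continuous (fun s : K => s - j%:R).
  by move=> x; apply: cvgB; [exact: cvg_id | exact: cvg_cst].
have ccl : continuous (fun s : K => clamp (s - j%:R)).
  by move=> x; apply: (@continuous_comp K K K (fun s => s - j%:R) (@clamp K)); [exact: csh | exact: clamp_continuous].
by apply: (@continuous_comp K K K (fun s => clamp (s - j%:R)) f); [exact: ccl | exact: cf].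
Qed.

Lemma iterate_pathE (K : realType) (N : nat) (s : K) : 0 <= s <= N%:R ->
  exists j : nat, 0 <= s - j%:R <= 1 /\
    forall f, iterate_path N f s = f (s - j%:R) + j%:R * (f 1 - f 0).
Proof.
elim: N => [|N IH] sN.
  have -> : s = 0 by lra.
  exists 0%N; split; first by rewrite subr0 zero_itv01.
  by move=> f; rewrite /iterate_path big_ord0 subr0; ring.
have [sltN|Nles] := ltP s N%:R.
  have [|j [j01 jE]] := IH; first by lra.
  exists j; split => // f; rewrite -jE /iterate_path big_ord_recr /=.
  by rewrite clamp_le0 ?subrr ?addr0 //; lra.
exists N; rewrite -natr1 in sN; split; first by lra.
move=> f; rewrite /iterate_path big_ord_recr /= clamp_id; last by lra.
rewrite (eq_bigr (fun=> f 1 - f 0)); last first.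
  move=> i _; rewrite clamp_ge1 //.
  have : i.+1%:R <= N%:R :> K by rewrite ler_nat.
  by rewrite -natr1; lra.
by rewrite sumr_const card_ord -mulr_natl; ring.
Qed.

Lemma path_bounded (K : realType) (f : K -> K) : continuous f ->
  exists B : K, forall t, 0 <= t <= 1 -> `|f t| <= B.
Proof.
move=> cf; have [|c _ cP] := @EVT_max K (fun t => `|f t|) 0 1 ler01.
  apply: continuous_within01 => t.
  by apply: (@continuous_comp _ _ _ f (fun x => `|x|)); [exact: cf | exact: norm_continuous].
by exists `|f c| => t t01; apply: cP; rewrite in_itv.
Qed.

(** (a, b) and (p, q) lift loops of the torus that wind once around the first
    and the second factor. Repeated often enough, the first becomes a long
    horizontal path and the second a long vertical one, and the theorem of
    Poincare and Miranda makes them cross. *)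
Lemma transverse_loops_meet (K : realType) (a b p q : K -> K) (D : K) :
  continuous a -> continuous b -> continuous p -> continuous q -> 0 < D ->
  a 1 = a 0 + D -> b 1 = b 0 -> p 1 = p 0 -> q 1 = q 0 + D ->
  exists s t (m n : int), [/\ 0 <= s <= 1, 0 <= t <= 1,
    a s - p t = m%:~R * D & b s - q t = n%:~R * D].
Proof.
move=> ca cb cp cq D0 a1 b1 p1 q1.
have [Ba BaP] := path_bounded ca; have [Bb BbP] := path_bounded cb.
have [Bp BpP] := path_bounded cp; have [Bq BqP] := path_bounded cq.
(* After M periods the drift of the paths exceeds their oscillation. *)
pose M := (Num.truncn ((Ba + Bb + Bp + Bq) / D)).+1.
have MD : Ba + Bb + Bp + Bq < M%:R * D.
  by rewrite -ltr_pdivrMr // truncnS_gt.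
pose N := (M + M)%N; have NE : N%:R = M%:R + M%:R :> K by rewrite natrD.
have M0 : 0 < M%:R :> K by rewrite ltr0n.
clearbody N; clearbody M.
have scale (s : K) : 0 <= s <= 1 -> 0 <= N%:R * s <= N%:R.
  by move=> /andP[s0 s1]; rewrite mulr_ge0 ?ler0n //= ler_piMr ?ler0n.
pose X (r : K * K) := iterate_path N a (N%:R * r.1) - iterate_path N p (N%:R * r.2) - M%:R * D.
pose Y (r : K * K) := iterate_path N q (N%:R * r.2) - iterate_path N b (N%:R * r.1) - M%:R * D.
have cfst (f : K -> K) : continuous f ->
    continuous (fun r : K * K => iterate_path N f (N%:R * r.1)).
  move=> cf r; apply: (@continuous_comp _ _ _ (fun r : K * K => N%:R * r.1)).
    by apply: cvgM; [exact: cvg_cst | exact: cvg_fst].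
  exact: iterate_path_continuous.
have csnd (f : K -> K) : continuous f ->
    continuous (fun r : K * K => iterate_path N f (N%:R * r.2)).
  move=> cf r; apply: (@continuous_comp _ _ _ (fun r : K * K => N%:R * r.2)).
    by apply: cvgM; [exact: cvg_cst | exact: cvg_snd].
  exact: iterate_path_continuous.
have cX : continuous X.
  move=> r; apply: cvgB; last exact: cvg_cst.
  by apply: cvgB; [exact: cfst | exact: csnd].
have cY : continuous Y.
  move=> r; apply: cvgB; last exact: cvg_cst.
  by apply: cvgB; [exact: csnd | exact: cfst].
have it0 (f : K -> K) : iterate_path N f (N%:R * 0) = f 0.
  rewrite mulr0 /iterate_path big1 ?addr0 // => i _.
  by rewrite clamp_le0 ?subrr // sub0r oppr_le0 ler0n.
have it1 (f : K -> K) : iterate_path N f (N%:R * 1) = f 0 + N%:R * (f 1 - f 0).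
  rewrite mulr1 /iterate_path (eq_bigr (fun=> f 1 - f 0)).
    by rewrite sumr_const card_ord mulr_natl.
  move=> i _; rewrite clamp_ge1 //.
  have : i.+1%:R <= N%:R :> K by rewrite ler_nat.
  by rewrite -natr1; lra.
have i0 := zero_itv01 K; have i1 := one_itv01 K.
have [| |[s t] [[/= s01 t01] [Xz Yz]]] := poincare_miranda cX cY.
- move=> t t01; rewrite /X /= it0 it1 a1.
  have [j [j01 ->]] := iterate_pathE (scale t t01); rewrite p1.
  have := BaP 0 i0; have := BpP _ j01; rewrite !ler_norml.
  have := BbP 0 i0; have := BqP 0 i0; rewrite !ler_norml NE; lra.
- move=> s s01; rewrite /Y /= it0 it1 q1.
  have [j [j01 ->]] := iterate_pathE (scale s s01); rewrite b1.
  have := BqP 0 i0; have := BbP _ j01; rewrite !ler_norml.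
  have := BaP 0 i0; have := BpP 0 i0; rewrite !ler_norml NE; lra.
rewrite !in_itv /= in s01 t01.
have [i [i01 iE]] := iterate_pathE (scale s s01).
have [j [j01 jE]] := iterate_pathE (scale t t01).
exists (N%:R * s - i%:R), (N%:R * t - j%:R), (M%:Z - i%:Z), (j%:Z - M%:Z).
split => //.
- by move: Xz; rewrite /X /= iE jE a1 p1 intrB; lra.
- by move: Yz; rewrite /Y /= iE jE b1 q1 intrB; lra.
Qed.

(** Loops on the torus with linearly independent homology classes (g1, g2) and
    (d1, d2) meet: a linear map, invertible because D is nonzero, sends the two
    classes to multiples of the coordinate vectors. *)
Theorem torus_loops_meet (K : realType) (w : K) (gx gy dx dy : K -> K)
    (g1 g2 d1 d2 : int) :
  continuous gx -> continuous gy -> continuous dx -> continuous dy -> 0 < w ->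
  gx 1 = gx 0 + g1%:~R * w -> gy 1 = gy 0 + g2%:~R * w ->
  dx 1 = dx 0 + d1%:~R * w -> dy 1 = dy 0 + d2%:~R * w ->
  g1 * d2 - g2 * d1 != 0 ->
  exists s t (m n : int), [/\ 0 <= s <= 1, 0 <= t <= 1,
    gx s - dx t = m%:~R * w & gy s - dy t = n%:~R * w].
Proof.
move=> cgx cgy cdx cdy w0 egx egy edx edy det0.
pose D : K := (g1 * d2 - g2 * d1)%:~R.
have DE : D = g1%:~R * d2%:~R - g2%:~R * d1%:~R by rewrite /D intrB !intrM.
have D0 : D != 0 by rewrite /D intr_eq0.
have lin (f h : K -> K) (u v : K) : continuous f -> continuous h ->
    continuous (fun s => D * (f s * u - h s * v)).
  move=> cf ch s; apply: cvgM; first exact: cvg_cst.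
  by apply: cvgB; apply: cvgM; try exact: cvg_cst; [exact: cf | exact: ch].
have [|||||s [t [m [n [s01 t01 em en]]]]] := @transverse_loops_meet K
  (fun s => D * (gx s * d2%:~R - gy s * d1%:~R))
  (fun s => D * (gy s * g1%:~R - gx s * g2%:~R))
  (fun s => D * (dx s * d2%:~R - dy s * d1%:~R))
  (fun s => D * (dy s * g1%:~R - dx s * g2%:~R)) (D ^+ 2 * w)
  (lin _ _ _ _ cgx cgy) (lin _ _ _ _ cgy cgx) (lin _ _ _ _ cdx cdy) (lin _ _ _ _ cdy cdx).
- by rewrite mulr_gt0 // exprn_even_gt0.
- by rewrite egx egy expr2 {4}DE; ring.
- by rewrite egx egy; ring.
- by rewrite edx edy; ring.
- by rewrite edx edy expr2 {4}DE; ring.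
exists s, t, (g1 * m + d1 * n), (g2 * m + d2 * n); split => //.
- apply: (mulfI D0); apply: (mulfI D0).
  rewrite intrD !intrM.
  transitivity (g1%:~R * (m%:~R * (D ^+ 2 * w)) + d1%:~R * (n%:~R * (D ^+ 2 * w))); last by ring.
  by rewrite -em -en [X in X * (_ - _)]DE; ring.
- apply: (mulfI D0); apply: (mulfI D0).
  rewrite intrD !intrM.
  transitivity (g2%:~R * (m%:~R * (D ^+ 2 * w)) + d2%:~R * (n%:~R * (D ^+ 2 * w))); last by ring.
  by rewrite -em -en [X in X * (_ - _)]DE; ring.
Qed.

(** * Drawings of K5 on the torus *)

Definition axis_dist (K : realType) (q : K * K * K) : K :=
  Num.sqrt (q.1.1 ^+ 2 + q.1.2 ^+ 2).

(** The two angular coordinates of the torus: around the axis, and around the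
    point at distance 2 from the axis in the half-plane section. *)
Definition torus_angles (K : realType) (q : K * K * K) (al be : K) : Prop :=
  has_angle al q.1.1 q.1.2 /\ has_angle be (axis_dist q - 2) q.2.

(** The section by a half-plane through the axis is an arc of the circle of
    radius 4, closed up by its chord at distance 1 from the axis. *)
Lemma torus_section (K : realType) (q : K * K * K) :
  @sphere_with_handles K 1 q -> 1 <= axis_dist q /\
    (axis_dist q ^+ 2 + q.2 ^+ 2 = 16 \/
     axis_dist q = 1 /\ q.2 ^+ 2 <= 15).
Proof.
case: q => [[x y] z]; rewrite /sphere_with_handles /axis_dist /=.
have -> : (3 * 1 + 1)%N%:R ^+ 2 = 16 :> K by rewrite -natrX.
have s0 : 0 <= x ^+ 2 + y ^+ 2 by rewrite addr_ge0 ?sqr_ge0.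
have se := sqr_sqrtr s0; have sg := sqrtr_ge0 (x ^+ 2 + y ^+ 2).
set r := Num.sqrt _ in se sg *.
move=> [[sph /(_ 0%N isT)]|[ball [i i1 cyl]]].
  rewrite muln0 subr0 -se => r1.
  by split; [rewrite -(@ler_pXn2r _ 2) ?nnegrE ?ler01 // expr1n | left; rewrite se].
move: i i1 cyl => [|//] _; rewrite muln0 subr0 => cyl.
have r1 : r = 1 by rewrite /r cyl sqrtr1.
by split; [rewrite r1 | right; split => //; lra].
Qed.

Lemma torus_nonzero (K : realType) (q : K * K * K) :
  @sphere_with_handles K 1 q ->
  (q.1.1, q.1.2) <> (0, 0) /\ (axis_dist q - 2, q.2) <> (0, 0).
Proof.
move=> /torus_section[r1 sec]; split=> [[x0 y0]|[r0 z0]].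
  by move: r1; rewrite /axis_dist x0 y0 expr0n /= addr0 sqrtr0 ler10.
have r2 : axis_dist q = 2 by lra.
by case: sec => [|[]]; rewrite r2 ?z0; lra.
Qed.

(** The half-plane section of the torus bounds a region star-shaped about the
    point at distance 2 from the axis, so that the two angles determine the
    point. *)
Lemma torus_angles_inj (K : realType) (q q' : K * K * K) (al be : K) :
  @sphere_with_handles K 1 q -> @sphere_with_handles K 1 q' ->
  torus_angles q al be -> torus_angles q' al be -> q = q'.
Proof.
move=> Sq Sq' [[r r0 [ex ey]] [s s0 [eu ez]]] [[r' r0' [ex' ey']] [s' s0' [eu' ez']]].
have [d1 sec] := torus_section Sq; have [d1' sec'] := torus_section Sq'.
have polar (p : K * K * K) (m : K) : 0 < m -> p.1.1 = m * cos al -> p.1.2 = m * sin al ->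
    axis_dist p = m.
  move=> m0 e1 e2; rewrite /axis_dist e1 e2 !exprMn -mulrDr cos2Dsin2 mulr1.
  by rewrite sqrtr_sqr ger0_norm // ltW.
have dr : axis_dist q = r by apply: polar.
have dr' : axis_dist q' = r' by apply: polar.
rewrite dr in d1 sec eu; rewrite dr' in d1' sec' eu'.
have cs := cos2Dsin2 be.
set c := cos be in cs eu eu'; set e := sin be in cs ez ez'.
have expand m : (2 + m * c) ^+ 2 + (m * e) ^+ 2 = 16 -> m * (m + 4 * c) = 12.
  move=> em; have : m ^+ 2 * (c ^+ 2 + e ^+ 2) + 4 * (m * c) = 12 by lra.
  by rewrite cs; lra.
have ss' : s = s'.
  (* Both points on the arc: the quadratic equation has one positive root. *)
  have key m n : 0 < m -> 0 < n ->
      (2 + m * c) ^+ 2 + (m * e) ^+ 2 = 16 -> (2 + n * c) ^+ 2 + (n * e) ^+ 2 = 16 -> m = n.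
    move=> m0 n0 em en.
    have fm := expand m em.
    have fn := expand n en.
    have : (m - n) * (m * n + 12) = 0.
      have -> : (m - n) * (m * n + 12) = n * (m * (m + 4 * c) - 12) - m * (n * (n + 4 * c) - 12).
        by ring.
      by rewrite fm fn subrr !mulr0 subrr.
    move/eqP; rewrite mulf_eq0 subr_eq0 => /orP[/eqP //|/eqP h].
    by have := mulr_gt0 m0 n0; lra.
  (* One point on the arc and one on the chord: they are the same corner. *)
  have mixed m n : 0 < m -> 0 < n -> 1 <= 2 + m * c ->
      (2 + m * c) ^+ 2 + (m * e) ^+ 2 = 16 -> n * c = -1 -> (n * e) ^+ 2 <= 15 -> m = n.
    move=> m0 n0 m1 em nc ne.
    have n2 : n ^+ 2 <= 16.
      have : n ^+ 2 * (c ^+ 2 + e ^+ 2) = (n * c) ^+ 2 + (n * e) ^+ 2 by ring.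
      by rewrite cs nc; lra.
    have fm := expand m em.
    have fmn : m * (m * n - 4) = 12 * n.
      have : m * (m + 4 * c) * n = m * (m * n + 4 * (n * c)) by ring.
      by rewrite fm nc; lra.
    have mn : m <= n.
      have h : 0 <= n * (1 + m * c) by apply: mulr_ge0; [exact: ltW | lra].
      have : n * (1 + m * c) = n + m * (n * c) by ring.
      by rewrite nc; lra.
    have n4 : n <= 4 by nra.
    have : (m - n) * (m + 3 * n) >= 0 by nra.
    nra.
  case: sec sec' => [E|[E1 E2]] [E'|[E1' E2']].
  - by apply: key => //; rewrite -?eu -?ez -?eu' -?ez'; lra.
  - apply: mixed => //; rewrite -?eu -?ez -?eu' -?ez'; lra.
  - apply/esym/mixed => //; rewrite -?eu -?ez -?eu' -?ez'; lra.
  - have nc : s * c = -1 by lra.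
    have nc' : s' * c = -1 by lra.
    have c0 : c != 0 by apply: contra_eq_neq nc => ->; rewrite mulr0 eq_sym oppr_eq0 oner_eq0.
    by apply: (mulIf c0); rewrite nc nc'.
have rr' : r = r' by rewrite ss' in eu; lra.
case: q q' ex ey ez ex' ey' ez' {Sq Sq' polar dr dr' d1 d1' sec sec' eu eu'} => [[x y] z] [[x' y'] z'] /=.
by move=> -> -> -> -> -> ->; rewrite ss' rr'.
Qed.

Lemma axis_dist_continuous (K : realType) (f : K -> K * K * K) :
  coord_continuous f -> continuous (fun t => axis_dist (f t)).
Proof.
move=> [cx cy _] t.
have c : continuous (fun t => (f t).1.1 ^+ 2 + (f t).1.2 ^+ 2).
  move=> u; apply: cvgD; rewrite expr2; apply: cvgM; try exact: cx; exact: cy.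
apply: (@continuous_comp _ _ _ (fun t => (f t).1.1 ^+ 2 + (f t).1.2 ^+ 2) Num.sqrt).
  exact: c.
exact: sqrt_continuous.
Qed.

Lemma torus_arc_lift (K : realType) (f : K -> K * K * K) (al0 be0 : K) :
  coord_continuous f -> (forall t, @sphere_with_handles K 1 (f t)) ->
  torus_angles (f 0) al0 be0 ->
  exists al be : K -> K, [/\ continuous al, continuous be, al 0 = al0, be 0 = be0 &
    forall t, 0 <= t <= 1 -> torus_angles (f t) (al t) (be t)].
Proof.
move=> cf Sf [ang1 ang2]; have [cx cy cz] := cf.
have [|al [cal al00 alP]] := path_lift cx cy _ ang1.
  by move=> t _; have [] := torus_nonzero (Sf t).
have cr : continuous (fun t => axis_dist (f t) - 2).
  by move=> t; apply: cvgB; [exact: axis_dist_continuous | exact: cvg_cst].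
have [|be [cbe be00 beP]] := path_lift cr cz _ ang2.
  by move=> t _; have [] := torus_nonzero (Sf t).
exists al, be; split => // t t01; split; [exact: alP | exact: beP].
Qed.

Lemma torus_anglesD2pi (K : realType) (q : K * K * K) (al be : K) (m n : int) :
  torus_angles q al be ->
  torus_angles q (al + m%:~R * (pi *+ 2)) (be + n%:~R * (pi *+ 2)).
Proof. by case=> *; split; exact: has_angleD2pi. Qed.

Lemma torus_angles_exists (K : realType) (q : K * K * K) :
  @sphere_with_handles K 1 q -> exists al be, torus_angles q al be.
Proof.
move=> /torus_nonzero[/has_angle_exists[al alP] /has_angle_exists[be beP]].
by exists al, be.
Qed.

(** The arcs lifted to the universal cover of the torus; (hx a b, hy a b) is the
    holonomy of the edge ab in the group of deck transformations. *)
Definition torus_lift (K : realType) (arc : 'I_5 -> 'I_5 -> K -> K * K * K)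
    (al be : 'I_5 -> K) (A B : 'I_5 -> 'I_5 -> K -> K) (hx hy : 'I_5 -> 'I_5 -> int) :=
  forall a b : 'I_5, (a < b)%N ->
  [/\ continuous (A a b) /\ continuous (B a b),
      A a b 0 = al a /\ B a b 0 = be a,
      A a b 1 = al b + (hx a b)%:~R * (pi *+ 2),
      B a b 1 = be b + (hy a b)%:~R * (pi *+ 2)
    & forall t, 0 <= t <= 1 -> torus_angles (arc a b t) (A a b t) (B a b t)].

Definition torus_K5 (K : realType) (pt : 'I_5 -> K * K * K)
    (arc : 'I_5 -> 'I_5 -> K -> K * K * K) : Prop :=
  [/\ K5_drawing pt arc,
      forall a, @sphere_with_handles K 1 (pt a),
      forall a b : 'I_5, (a < b)%N -> coord_continuous (arc a b)
    & forall (a b : 'I_5) t, (a < b)%N -> @sphere_with_handles K 1 (arc a b t)].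

(** Moving the chosen angles of each vertex along the edge from vertex 0 kills
    the holonomy of the spanning star at 0. *)
Lemma torus_lift_exists (K : realType) (pt : 'I_5 -> K * K * K)
    (arc : 'I_5 -> 'I_5 -> K -> K * K * K) :
  torus_K5 pt arc ->
  exists al be A B hx hy, torus_lift arc al be A B hx hy /\
    forall b : 'I_5, (0 < b)%N -> hx ord0 b = 0 /\ hy ord0 b = 0.
Proof.
move=> [[ends dis] Spt carc Sarc].
have /choice[ang angP] : forall a, exists ab : K * K, torus_angles (pt a) ab.1 ab.2.
  by move=> a; have [al [be abP]] := torus_angles_exists (Spt a); exists (al, be).
have /choice[L LP] : forall ab : 'I_5 * 'I_5, exists L : (K -> K) * (K -> K) * (int * int),
    (ab.1 < ab.2)%N ->
    [/\ continuous L.1.1 /\ continuous L.1.2,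
      L.1.1 0 = (ang ab.1).1 /\ L.1.2 0 = (ang ab.1).2,
      L.1.1 1 = (ang ab.2).1 + L.2.1%:~R * (pi *+ 2),
      L.1.2 1 = (ang ab.2).2 + L.2.2%:~R * (pi *+ 2)
    & forall t, 0 <= t <= 1 -> torus_angles (arc ab.1 ab.2 t) (L.1.1 t) (L.1.2 t)].
  move=> [a b] /=; case: ltnP => ab; last by exists (id, id, (0, 0)).
  have [e0 e1] := ends a b ab.
  have ang0 : torus_angles (arc a b 0) (ang a).1 (ang a).2 by rewrite e0.
  have [al [be [cal cbe al0 be0 alb]]] :=
    torus_arc_lift (carc a b ab) (fun t => Sarc a b t ab) ang0.
  have [l1 l2] := alb 1 (one_itv01 K); have [v1 v2] := angP b.
  rewrite e1 in l1 l2.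
  have [m mP] := has_angle_inj v1 l1; have [n nP] := has_angle_inj v2 l2.
  by exists (al, be, (m, n)).
pose ux (a : 'I_5) : int := if a == ord0 then 0 else (L (ord0, a)).2.1.
pose uy (a : 'I_5) : int := if a == ord0 then 0 else (L (ord0, a)).2.2.
exists (fun a => (ang a).1 + (ux a)%:~R * (pi *+ 2)),
  (fun a => (ang a).2 + (uy a)%:~R * (pi *+ 2)),
  (fun a b t => (L (a, b)).1.1 t + (ux a)%:~R * (pi *+ 2)),
  (fun a b t => (L (a, b)).1.2 t + (uy a)%:~R * (pi *+ 2)),
  (fun a b => (L (a, b)).2.1 + ux a - ux b),
  (fun a b => (L (a, b)).2.2 + uy a - uy b); split.
  move=> a b ab; have [[c1 c2] [z1 z2] o1 o2 angL] := LP (a, b) ab; split.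
  - by split=> t; apply: cvgD; [exact: c1 | exact: cvg_cst | exact: c2 | exact: cvg_cst].
  - by rewrite z1 z2.
  - by rewrite o1 /= intrB intrD; ring.
  - by rewrite o2 /= intrB intrD; ring.
  - by move=> t t01; apply: torus_anglesD2pi; exact: angL.
move=> b b0; rewrite /ux /uy eqxx.
have -> : (b == ord0) = false by apply/negbTE; rewrite -val_eqE -lt0n.
by split; rewrite addr0 subrr.
Qed.

(** When every holonomy is a multiple of one primitive vector (c1, c2), the
    drawing lifts to the annulus covering the torus with that deck group, which
    embeds in the plane. *)
Lemma torus_lift_rank2 (K : realType) (pt : 'I_5 -> K * K * K)
    (arc : 'I_5 -> 'I_5 -> K -> K * K * K)
    al be A B hx hy (c1 c2 u v : int) :
  torus_K5 pt arc -> torus_lift arc al be A B hx hy ->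
  u * c1 + v * c2 = 1 ->
  ~ (forall a b : 'I_5, (a < b)%N ->
       exists m : int, hx a b = m * c1 /\ hy a b = m * c2).
Proof.
move=> [[_ dis] _ _ Sarc] lft bez rank1.
have bezR : u%:~R * c1%:~R + v%:~R * c2%:~R = 1 :> K by rewrite -!intrM -intrD bez.
pose X (x y : K) := c2%:~R * x - c1%:~R * y.
pose P (x y : K) := u%:~R * x + v%:~R * y.
pose E x y : K * K := (expR (X x y) * cos (P x y), expR (X x y) * sin (P x y)).
have EP x y m : E (x + (m * c1)%:~R * (pi *+ 2)) (y + (m * c2)%:~R * (pi *+ 2)) = E x y.
  have eX : X (x + (m * c1)%:~R * (pi *+ 2)) (y + (m * c2)%:~R * (pi *+ 2)) = X x y.
    by rewrite /X !intrM; ring.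
  have eP : P (x + (m * c1)%:~R * (pi *+ 2)) (y + (m * c2)%:~R * (pi *+ 2))
      = P x y + m%:~R * (pi *+ 2).
    transitivity (P x y + (u%:~R * c1%:~R + v%:~R * c2%:~R) * (m%:~R * (pi *+ 2))).
      by rewrite /P !intrM; ring.
    by rewrite bezR mul1r.
  by rewrite /E eX eP; have [-> ->] := cos_sinD2piz (P x y) m.
have Einj x y x' y' : E x y = E x' y' -> exists m : int,
    x' = x + (m * c1)%:~R * (pi *+ 2) /\ y' = y + (m * c2)%:~R * (pi *+ 2).
  move=> [e1 e2].
  have eX : X x y = X x' y'.
    apply: expR_inj; apply/eqP; rewrite -(@eqrXn2 _ 2) ?expR_ge0 //; apply/eqP.
    rewrite -[LHS]mulr1 -[RHS]mulr1 -{1}(cos2Dsin2 (P x y)) -(cos2Dsin2 (P x' y')).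
    by rewrite !mulrDr -!exprMn e1 e2.
  have h : has_angle (P x y) (expR (X x y) * cos (P x y)) (expR (X x y) * sin (P x y)).
    by exists (expR (X x y)); rewrite ?expR_gt0.
  have h' : has_angle (P x' y') (expR (X x y) * cos (P x y)) (expR (X x y) * sin (P x y)).
    by exists (expR (X x' y')); rewrite ?expR_gt0.
  have [m mP] := has_angle_inj h h'.
  (* The matrix of (X, P) is unimodular. *)
  have xE s t : s = v%:~R * X s t + c1%:~R * P s t.
    transitivity ((u%:~R * c1%:~R + v%:~R * c2%:~R) * s); last by rewrite /X /P; ring.
    by rewrite bezR mul1r.
  have yE s t : t = c2%:~R * P s t - u%:~R * X s t.
    transitivity ((u%:~R * c1%:~R + v%:~R * c2%:~R) * t); last by rewrite /X /P; ring.
    by rewrite bezR mul1r.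
  exists m; split; rewrite intrM.
    by rewrite [LHS](xE _ y') [x in RHS](xE _ y) -eX mP; ring.
  by rewrite [LHS](yE x') [y in RHS](yE x) -eX mP; ring.
have cXP (a b : 'I_5) : (a < b)%N -> continuous (fun t => X (A a b t) (B a b t)) /\
    continuous (fun t => P (A a b t) (B a b t)).
  move=> ab; have [[cA cB] _ _ _ _] := lft a b ab; split=> t.
    by apply: cvgB; apply: cvgM; try exact: cvg_cst; [exact: cA | exact: cB].
  by apply: cvgD; apply: cvgM; try exact: cvg_cst; [exact: cA | exact: cB].
apply: (@K5_nonplanar K (fun a => E (al a) (be a)) (fun a b t => E (A a b t) (B a b t))).
- move=> a b ab t; have [cX cP] := cXP a b ab; apply: cvgM.
    by apply: (@continuous_comp _ _ _ (fun t => X (A a b t) (B a b t)) expR);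
      [exact: cX | exact: continuous_expR].
  by apply: (@continuous_comp _ _ _ (fun t => P (A a b t) (B a b t)) cos);
    [exact: cP | exact: continuous_cos].
- move=> a b ab t; have [cX cP] := cXP a b ab; apply: cvgM.
    by apply: (@continuous_comp _ _ _ (fun t => X (A a b t) (B a b t)) expR);
      [exact: cX | exact: continuous_expR].
  by apply: (@continuous_comp _ _ _ (fun t => P (A a b t) (B a b t)) sin);
    [exact: cP | exact: continuous_sin].
split.
  move=> a b ab; have [_ [-> ->] -> -> _] := lft a b ab.
  by have [m [-> ->]] := rank1 a b ab; rewrite EP.
move=> a b c d ab cd un s t s01 t01 /Einj[m [ex ey]].
apply: (dis a b c d ab cd un s t s01 t01).
have [_ _ _ _ /(_ s s01) ls] := lft a b ab.
have [_ _ _ _ /(_ t t01) lt] := lft c d cd.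
apply: (torus_angles_inj (Sarc _ _ _ ab) (Sarc _ _ _ cd) _ lt).
by rewrite ex ey; exact: torus_anglesD2pi.
Qed.

(** As the edges at 0 have no holonomy, the boundary of the triangle 0ab lifts
    to a path between two lifts of 0 that differ by the holonomy of ab. *)
Lemma torus_triangle_loop (K : realType) (arc : 'I_5 -> 'I_5 -> K -> K * K * K)
    al be A B hx hy (a b : 'I_5) :
  torus_lift arc al be A B hx hy ->
  (forall b : 'I_5, (0 < b)%N -> hx ord0 b = 0 /\ hy ord0 b = 0) ->
  (0 < a)%N -> (a < b)%N ->
  exists gx gy : K -> K, [/\ continuous gx /\ continuous gy,
    gx 1 = gx 0 + (hx a b)%:~R * (pi *+ 2), gy 1 = gy 0 + (hy a b)%:~R * (pi *+ 2) &
    forall s, 0 <= s <= 1 -> exists (i j : 'I_5) t,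
      [/\ (i < j)%N, 0 <= t <= 1 & torus_angles (arc i j t) (gx s) (gy s)]].
Proof.
move=> lft h0 a0 ab; have b0 : (0 < b)%N by apply: ltn_trans ab.
have [[cAa cBa] [Aa0 Ba0] Aa1 Ba1 anga] := lft ord0 a a0.
have [[cAb cBb] [Ab0 Bb0] Ab1 Bb1 angb] := lft ord0 b b0.
have [[cAc cBc] [Ac0 Bc0] Ac1 Bc1 angc] := lft a b ab.
have [xa ya] := h0 a a0; have [xb yb] := h0 b b0.
rewrite xa mul0r addr0 in Aa1; rewrite ya mul0r addr0 in Ba1.
rewrite xb mul0r addr0 in Ab1; rewrite yb mul0r addr0 in Bb1.
pose loop (p q r : K -> K) (s : K) := p (clamp (3 * s)) + (q (clamp (3 * s - 1)) - q 0)
  + (r (clamp (3 - 3 * s)) - r 1).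
have cloop (p q r : K -> K) : continuous p -> continuous q -> continuous r -> continuous (loop p q r).
  have cc (f g : K -> K) : continuous f -> continuous g ->
      continuous (fun s => f (clamp (g s))).
    move=> cf cg s; apply: (@continuous_comp K K K (fun s => clamp (g s)) f); last exact: cf.
    by apply: (@continuous_comp K K K g (@clamp K)); [exact: cg | exact: clamp_continuous].
  have c3 : continuous (fun s : K => 3 * s).
    by move=> s; apply: cvgM; [exact: cvg_cst | exact: cvg_id].
  move=> cp cq cr s; apply: cvgD; last first.
    apply: cvgB; last exact: cvg_cst.
    by apply: cc => // u; apply: cvgB; [exact: cvg_cst | exact: c3].
  apply: cvgD; first exact: cc.
  apply: cvgB; last exact: cvg_cst.
  by apply: cc => // u; apply: cvgB; [exact: c3 | exact: cvg_cst].
have first_leg (p q r : K -> K) (s : K) : 0 <= 3 * s <= 1 -> loop p q r s = p (3 * s).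
  move=> s1; rewrite /loop clamp_id // clamp_le0 ?clamp_ge1 ?subrr ?addr0 //; lra.
have second_leg (p q r : K -> K) (s : K) : 0 <= 3 * s - 1 <= 1 -> p 1 = q 0 -> loop p q r s = q (3 * s - 1).
  move=> s1 pq; rewrite /loop (@clamp_ge1 _ (3 * s)); last by lra.
  rewrite clamp_id // (@clamp_ge1 _ (3 - 3 * s)); last by lra.
  by rewrite pq; ring.
have third_leg (p q r : K -> K) (s : K) : 0 <= 3 - 3 * s <= 1 -> p 1 = q 0 ->
    loop p q r s = r (3 - 3 * s) + (q 1 - r 1).
  move=> s1 pq; rewrite /loop (@clamp_ge1 _ (3 * s)); last by lra.
  rewrite (@clamp_ge1 _ (3 * s - 1)); last by lra.
  by rewrite clamp_id // pq; ring.
have loop0 (p q r : K -> K) : loop p q r 0 = p 0.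
  by rewrite first_leg ?mulr0 // zero_itv01.
have loop1 (p q r : K -> K) : p 1 = q 0 -> loop p q r 1 = r 0 + (q 1 - r 1).
  by move=> pq; rewrite third_leg ?mulr1 ?subrr // zero_itv01.
exists (loop (A ord0 a) (A a b) (A ord0 b)), (loop (B ord0 a) (B a b) (B ord0 b)).
split.
- by split; exact: cloop.
- by rewrite loop0 loop1 ?Aa1 // Ab0 Aa0 Ac1 Ab1; ring.
- by rewrite loop0 loop1 ?Ba1 // Bb0 Ba0 Bc1 Bb1; ring.
move=> s s01; have [s1|s1] := leP (3 * s) 1.
  exists ord0, a, (3 * s); rewrite !first_leg; try lra.
  by split => //; [lra | apply: anga; lra].
have [s2|s2] := leP (3 * s - 1) 1.
  exists a, b, (3 * s - 1); rewrite !second_leg ?Aa1 ?Ba1 //; try lra.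
  by split => //; [lra | apply: angc; lra].
exists ord0, b, (3 - 3 * s); rewrite !third_leg ?Aa1 ?Ba1 //; try lra.
split => //; first by lra.
have -> : A a b 1 - A ord0 b 1 = (hx a b)%:~R * (pi *+ 2) by rewrite Ac1 Ab1; ring.
have -> : B a b 1 - B ord0 b 1 = (hy a b)%:~R * (pi *+ 2) by rewrite Bc1 Bb1; ring.
by apply: torus_anglesD2pi; apply: angb; lra.
Qed.

Theorem two_K5_torus (K : realType) (pt pt' : 'I_5 -> K * K * K)
    (arc arc' : 'I_5 -> 'I_5 -> K -> K * K * K) :
  torus_K5 pt arc -> torus_K5 pt' arc' ->
  ~ (forall (a b c d : 'I_5) s t, (a < b)%N -> (c < d)%N ->
       0 <= s <= 1 -> 0 <= t <= 1 -> arc a b s <> arc' c d t).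
Proof.
move=> T T' dis.
have [al [be [A [B [hx [hy [lft h0]]]]]]] := torus_lift_exists T.
have [al' [be' [A' [B' [hx' [hy' [lft' h0']]]]]]] := torus_lift_exists T'.
have [_ _ _ S1] := T; have [_ _ _ S1'] := T'.
have pos (a b : 'I_5) (h : 'I_5 -> 'I_5 -> int) : (forall b : 'I_5, (0 < b)%N -> h ord0 b = 0) ->
    (a < b)%N -> h a b != 0 -> (0 < a)%N.
  move=> hz ab; case: posnP => // a0; have a00 : a = ord0 by apply: val_inj.
  by rewrite a0 in ab; rewrite a00 hz ?eqxx.
have [a [b [ab hab]]] : exists a b : 'I_5, (a < b)%N /\ (hx a b, hy a b) <> (0, 0).
  apply: contrapT => noh.
  apply: (torus_lift_rank2 (c1 := 1) (c2 := 0) (u := 1) (v := 0) T lft).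
    by rewrite mulr0 addr0 mulr1.
  move=> a b ab; exists 0; rewrite !mul0r; apply: contrapT => ne; apply: noh.
  by exists a, b; split => // -[e1 e2]; apply: ne.
have a0 : (0 < a)%N.
  have [ex|nx] := eqVneq (hx a b) 0; last by apply: pos ab nx => c /h0[].
  have [ey|ny] := eqVneq (hy a b) 0; last by apply: pos ab ny => c /h0[].
  by rewrite ex ey in hab.
pose g1 := hx a b; pose g2 := hy a b.
have [a' [b' [ab' det]]] : exists a' b' : 'I_5, (a' < b')%N /\
    g1 * hy' a' b' - g2 * hx' a' b' != 0.
  apply: contrapT => nodet.
  pose d := gcdz g1 g2.
  have d0 : d != 0.
    rewrite /d gcdz_eq0; apply/negP => /andP[/eqP e1 /eqP e2].
    by apply: hab; rewrite -/g1 -/g2 e1 e2.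
  have [u [v bez]] := Bezoutz g1 g2.
  have [c1 e1] : exists c, g1 = c * d by exists (g1 %/ d)%Z; rewrite divzK // dvdz_gcdl.
  have [c2 e2] : exists c, g2 = c * d by exists (g2 %/ d)%Z; rewrite divzK // dvdz_gcdr.
  have bez1 : u * c1 + v * c2 = 1.
    by apply: (mulIf d0); rewrite mul1r mulrDl -!mulrA -e1 -e2.
  have := torus_lift_rank2 T' lft' bez1; apply => i j ij.
  have e : c1 * hy' i j = c2 * hx' i j.
    apply: (mulIf d0); rewrite mulrAC -e1 mulrAC -e2; apply/eqP; rewrite -subr_eq0.
    by apply: contrapT => /negP ne; apply: nodet; exists i, j.
  exists (u * hx' i j + v * hy' i j); split.
    transitivity ((u * c1 + v * c2) * hx' i j); first by rewrite bez1 mul1r.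
    rewrite !mulrDl -[v * c2 * _]mulrA -e; ring.
  transitivity ((u * c1 + v * c2) * hy' i j); first by rewrite bez1 mul1r.
  rewrite !mulrDl -[u * c1 * _]mulrA e; ring.
have a0' : (0 < a')%N.
  have [ex|nx] := eqVneq (hx' a' b') 0; last by apply: pos ab' nx => c /h0'[].
  have [ey|ny] := eqVneq (hy' a' b') 0; last by apply: pos ab' ny => c /h0'[].
  by rewrite ex ey !mulr0 subrr eqxx in det.
have [gx [gy [[cgx cgy] gx1 gy1 gP]]] := torus_triangle_loop lft h0 a0 ab.
have [dx [dy [[cdx cdy] dx1 dy1 dP]]] := torus_triangle_loop lft' h0' a0' ab'.
have tp : 0 < pi *+ 2 :> K by have := @pi_gt0 K; lra.
have [s [t [m [n [s01 t01 em en]]]]] :=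
  torus_loops_meet cgx cgy cdx cdy tp gx1 gy1 dx1 dy1 det.
have [i [j [r [ij r01 angr]]]] := gP s s01.
have [i' [j' [r' [ij' r01' angr']]]] := dP t t01.
apply: (dis i j i' j' r r' ij ij' r01 r01').
apply: (torus_angles_inj (S1 _ _ _ ij) (S1' _ _ _ ij') angr).
have -> : gx s = dx t + m%:~R * (pi *+ 2) by rewrite -em; ring.
have -> : gy s = dy t + n%:~R * (pi *+ 2) by rewrite -en; ring.
exact: torus_anglesD2pi.
Qed.

(** * Embedded cliques on the sphere and on the torus *)

Lemma clamp_comp_continuous (K : realType) (T : topologicalType) (f : K -> T) :
  {within `[0, 1], continuous f} -> continuous (f \o @clamp K).
Proof.
move=> /subspace_continuousP cf t U fU.
have A01 s : `[0 : K, 1] (clamp s) by rewrite /= in_itv /=; exact: clamp_itv.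
have nU := cf _ (A01 t) U fU.
have : nbhs t (@clamp K @^-1` [set y | `[0 : K, 1] y -> U (f y)]).
  exact: (clamp_continuous nU).
by apply: filterS => s /=; apply; exact: A01.
Qed.

Lemma itv01_split (K : realType) (t : K) : 0 <= t <= 1 ->
  [\/ t = 0, t = 1 | t \in `]0, 1[%R].
Proof.
move=> /andP[t0 t1]; have [->|n0] := eqVneq t 0; first by constructor 1.
have [->|n1] := eqVneq t 1; first by constructor 2.
by constructor 3; rewrite in_itv /= !lt_neqAle eq_sym n0 t0 n1 t1.
Qed.

(** Precomposing with [clamp] extends the arcs continuously to the whole line,
    and disjoint interiors that avoid the vertices give disjoint closed arcs. *)
Lemma embeds_in_closed_arcs (K : realType) (V : finType) (adj : rel V)
    (S : set (K * K * K)) :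
  symmetric adj -> embeds_in adj S ->
  exists (pt : V -> K * K * K) (arc : V -> V -> K -> K * K * K),
    [/\ forall v, S (pt v),
        forall u v, adj u v -> coord_continuous (arc u v) /\ forall t, S (arc u v t),
        forall u v, adj u v -> arc u v 0 = pt u /\ arc u v 1 = pt v,
        forall u v w t, adj u v -> w != u -> w != v -> arc u v t <> pt w
      & forall u v u' v' s t, adj u v -> adj u' v' -> uniq [:: u; v; u'; v'] ->
          arc u v s <> arc u' v' t].
Proof.
move=> adjC [pt [arc [[ptI ptS] isarc _ off dis]]].
have off' u v w t : adj u v -> w != u -> w != v -> 0 <= t <= 1 -> arc u v t <> pt w.
  move=> uv wu wv /itv01_split; have [_ _ _ a0 a1] := isarc u v uv.
  case=> [->|->|t01]; last exact: off.
    by rewrite a0 => /ptI e; rewrite e eqxx in wu.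
  by rewrite a1 => /ptI e; rewrite e eqxx in wv.
exists pt, (fun u v => arc u v \o @clamp K); split => //.
- move=> u v uv; have [cf _ fS _ _] := isarc u v uv.
  have cc := clamp_comp_continuous cf; split; last first.
    by move=> t; apply: fS; rewrite in_itv /=; exact: clamp_itv.
  have c1 (g : K * K * K -> K) : continuous g ->
      continuous (fun t => g ((arc u v \o @clamp K) t)).
    move=> cg t; apply: (@continuous_comp _ _ _ (arc u v \o @clamp K) g); last exact: cg.
    exact: cc.
  split; [apply: (c1 (fun q => q.1.1)) | apply: (c1 (fun q => q.1.2)) | apply: (c1 snd)].
  - by move=> q; apply: (@continuous_comp _ _ _ fst fst); exact: cvg_fst.
  - by move=> q; apply: (@continuous_comp _ _ _ fst snd); [exact: cvg_fst | exact: cvg_snd].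
  - by move=> q; exact: cvg_snd.
- move=> u v uv; have [_ _ _ a0 a1] := isarc u v uv.
  by rewrite /= !clamp_id ?zero_itv01 ?one_itv01.
- by move=> u v w t uv wu wv; apply: off' => //; exact: clamp_itv.
move=> u v u' v' s t uv uv' /=.
rewrite !inE !negb_or => /and4P[/and3P[_ uu' uv''] /andP[vu' vv'] _ _].
have [_ _ _ a0 a1] := isarc u v uv.
have s01 := clamp_itv s; have t01 := clamp_itv t.
case: (itv01_split s01) => [->|->|si].
- by rewrite a0 => /esym; apply: off'.
- by rewrite a1 => /esym; apply: off'.
have [_ _ _ b0 b1] := isarc u' v' uv'.
case: (itv01_split t01) => [->|->|ti].
- by rewrite b0; apply: off'; rewrite // eq_sym.
- by rewrite b1; apply: off'; rewrite // eq_sym.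
apply: dis => //; first by move=> [e _]; rewrite e eqxx in uu'.
by move=> [e _]; rewrite e eqxx in uv''.
Qed.

(** The sixth vertex supplies a point of the sphere that the other five and
    their edges avoid. *)
Theorem K6_not_in_sphere (K : realType) (V : finType) (adj : rel V) (w : 'I_6 -> V) :
  symmetric adj -> injective w -> (forall i j, i != j -> adj (w i) (w j)) ->
  ~ embeds_in adj (@sphere_with_handles K 0).
Proof.
move=> adjC wI wadj /(embeds_in_closed_arcs adjC)[pt [arc [ptS arcS ends off dis]]].
have S1 q : @sphere_with_handles K 0 q -> dot3 q q = 1.
  case: q => [[x y] z] [[+ _]|[_ [i]] //].
  by rewrite muln0 add0n expr1n /dot3 /= -!expr2.
pose u (i : 'I_5) := w (widen_ord (isT : 5 <= 6)%N i).
have uI : injective u.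
  by move=> i j /wI /(congr1 val) /= ij; apply: val_inj.
have uadj (a b : 'I_5) : (a < b)%N -> adj (u a) (u b).
  by move=> ab; apply: wadj; rewrite -val_eqE /= neq_ltn ab.
apply: (@K5_punctured_sphere K (pt (w ord_max)) (pt \o u) (fun a b => arc (u a) (u b))).
- exact/S1/ptS.
- by move=> a b /uadj/arcS[].
- by move=> a b t /uadj/arcS[_ aS]; exact/S1/aS.
- move=> a b t ab; apply: off; [exact: uadj| |]; rewrite (inj_eq wI) -val_eqE /=;
    by rewrite neq_ltn ltn_ord orbT.
split; first by move=> a b /uadj/ends.
move=> a b c d ab cd un s t _ _; apply: dis; [exact: uadj | exact: uadj|].
by rewrite (map_inj_uniq uI [:: a; b; c; d]).
Qed.

Theorem two_K5_not_in_torus (K : realType) (V : finType) (adj : rel V)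
    (w w' : 'I_5 -> V) :
  symmetric adj -> injective w -> injective w' -> (forall i j, w i != w' j) ->
  (forall i j, i != j -> adj (w i) (w j)) ->
  (forall i j, i != j -> adj (w' i) (w' j)) ->
  ~ embeds_in adj (@sphere_with_handles K 1).
Proof.
move=> adjC wI wI' ww' wadj wadj' /(embeds_in_closed_arcs adjC).
move=> [pt [arc [ptS arcS ends off dis]]].
have toK5 (u : 'I_5 -> V) : injective u -> (forall i j, i != j -> adj (u i) (u j)) ->
    torus_K5 (pt \o u) (fun a b => arc (u a) (u b)).
  move=> uI uadj0.
  have uadj (a b : 'I_5) : (a < b)%N -> adj (u a) (u b).
    by move=> ab; apply: uadj0; rewrite -val_eqE /= neq_ltn ab.
  split.
  - split; first by move=> a b /uadj/ends.
    move=> a b c d ab cd un s t _ _; apply: dis; [exact: uadj | exact: uadj|].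
    by rewrite (map_inj_uniq uI [:: a; b; c; d]).
  - by move=> a; exact: ptS.
  - by move=> a b /uadj/arcS[].
  - by move=> a b t /uadj/arcS[_ aS]; exact: aS.
apply: (two_K5_torus (toK5 w wI wadj) (toK5 w' wI' wadj')).
move=> a b c d s t ab cd _ _.
have ne (i j : 'I_5) : (i < j)%N -> i != j by move=> ij; rewrite -val_eqE /= neq_ltn ij.
apply: dis; [exact/wadj/ne | exact/wadj'/ne|].
by rewrite /= !inE !negb_or !ww' (inj_eq wI) (inj_eq wI') !ne.
Qed.

(** * Four copies of K4 on the sphere *)

Definition inv_stereographic (K : realType) (p : K * K) : K * K * K :=
  let n := 1 + p.1 ^+ 2 + p.2 ^+ 2 in
  (2 * p.1 / n, 2 * p.2 / n, 1 - 2 / n).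

Lemma inv_stereographic_denom (K : realType) (x y : K) : 0 < 1 + x ^+ 2 + y ^+ 2.
Proof. by have := sqr_ge0 x; have := sqr_ge0 y; lra. Qed.

Lemma inv_stereographic_inj (K : realType) : injective (@inv_stereographic K).
Proof.
move=> [x y] [x' y']; rewrite /inv_stereographic /=.
have n0 := inv_stereographic_denom x y; have n0' := inv_stereographic_denom x' y'.
set n := 1 + x ^+ 2 + _ in n0 *; set n' := 1 + x' ^+ 2 + _ in n0' *.
move=> [ex ey ez].
have nn : n^-1 = n'^-1 by lra.
have i0 : n'^-1 != 0 by rewrite invr_eq0 gt_eqF.
rewrite nn in ex ey; congr pair.
  by have /(mulfI (ltac:(by rewrite pnatr_eq0) : 2 != 0 :> K)) := mulIf i0 ex.
by have /(mulfI (ltac:(by rewrite pnatr_eq0) : 2 != 0 :> K)) := mulIf i0 ey.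
Qed.

Lemma inv_stereographic_sphere (K : realType) (p : K * K) :
  @sphere_with_handles K 0 (inv_stereographic p).
Proof.
case: p => x y; left; split => //=.
have := inv_stereographic_denom x y; set n := 1 + _ + _ => n0.
have n0' : n != 0 by rewrite gt_eqF.
have -> : (3 * 0 + 1)%N%:R = 1 :> K by [].
rewrite /n in n0' *; field.
by [].
Qed.

Lemma inv_stereographic_continuous (K : realType) (x y : K -> K) :
  continuous x -> continuous y -> continuous (fun t => inv_stereographic (x t, y t)).
Proof.
move=> cx cy t.
have cn : continuous (fun t => (1 + x t ^+ 2 + y t ^+ 2)^-1).
  move=> u; apply: cvgV; first by rewrite gt_eqF // inv_stereographic_denom.
  apply: cvgD; last by rewrite expr2; apply: cvgM; exact: cy.
  by apply: cvgD; [exact: cvg_cst | rewrite expr2; apply: cvgM; exact: cx].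
apply: (@cvg_pair _ _ _ (nbhs t) (nbhs _) (nbhs _)) => /=.
  apply: (@cvg_pair _ _ _ (nbhs t) (nbhs _) (nbhs _)) => /=.
    apply: cvgM; last exact: cn.
    by apply: cvgM; [exact: cvg_cst | exact: cx].
  apply: cvgM; last exact: cn.
  by apply: cvgM; [exact: cvg_cst | exact: cy].
apply: cvgB; first exact: cvg_cst.
by apply: cvgM; [exact: cvg_cst | exact: cn].
Qed.

(** A straight-line drawing of K4: a triangle and an interior point. *)
Section StraightK4.
Variable K : realType.

Definition K4x (j : 'I_4) : K := if j == 1%N :> nat then 3 else if j == 3%N :> nat then 1 else 0.
Definition K4y (j : 'I_4) : K := if j == 2%N :> nat then 3 else if j == 3%N :> nat then 1 else 0.

Lemma K4x_bounds j : 0 <= K4x j <= 3.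
Proof. by rewrite /K4x; case: ifP => _; [|case: ifP => _]; lra. Qed.

Lemma K4_vertex_inj j k : K4x j = K4x k -> K4y j = K4y k -> j = k.
Proof.
move=> ex ey; apply: val_inj; move: ex ey; rewrite /K4x /K4y.
by case: j k => -[|[|[|[|//]]]] ? [[|[|[|[|//]]]] ?] /= ex ey //; exfalso; lra.
Qed.

Lemma K4_segment_vertex j k l (t : K) : j != k -> t \in `]0, 1[%R ->
  K4x j + t * (K4x k - K4x j) = K4x l -> K4y j + t * (K4y k - K4y j) <> K4y l.
Proof.
rewrite in_itv /= => jk t01 ex ey; move: jk ex ey; rewrite -val_eqE /K4x /K4y.
case: j k l => -[|[|[|[|//]]]] ? [[|[|[|[|//]]]] ?] [[|[|[|[|//]]]] ?] //= _ ex ey;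
  lra.
Qed.

Lemma K4_segment_inj j k (t t' : K) : j != k ->
  K4x j + t * (K4x k - K4x j) = K4x j + t' * (K4x k - K4x j) ->
  K4y j + t * (K4y k - K4y j) = K4y j + t' * (K4y k - K4y j) -> t = t'.
Proof.
rewrite -val_eqE /K4x /K4y.
by case: j k => -[|[|[|[|//]]]] ? [[|[|[|[|//]]]] ?] //= _ ex ey; lra.
Qed.

Lemma K4_segments_disjoint j k j' k' (t t' : K) : j != k -> j' != k' ->
  t \in `]0, 1[%R -> t' \in `]0, 1[%R ->
  K4x j + t * (K4x k - K4x j) = K4x j' + t' * (K4x k' - K4x j') ->
  K4y j + t * (K4y k - K4y j) = K4y j' + t' * (K4y k' - K4y j') ->
  (j, k) = (j', k') \/ (j, k) = (k', j').
Proof.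
rewrite !in_itv /= => jk jk' t01 t01' ex ey.
suff : [|| ((j == j' :> nat) && (k == k' :> nat)) | ((j == k' :> nat) && (k == j' :> nat))].
  by move=> /orP[] /andP[/eqP/val_inj -> /eqP/val_inj ->]; [left | right].
move: jk jk' ex ey; rewrite -!val_eqE /K4x /K4y.
case: j k j' k' => -[|[|[|[|//]]]] ? [[|[|[|[|//]]]] ?] [[|[|[|[|//]]]] ?] [[|[|[|[|//]]]] ?] //= _ _ ex ey;
  exfalso; lra.
Qed.
End StraightK4.

Lemma index_enum_inj (T : finType) (A : {set T}) (x y : T) :
  x \in A -> y \in A -> index x (enum A) = index y (enum A) -> x = y.
Proof.
move=> xA yA e; rewrite -(nth_index x (_ : x \in enum A)) ?mem_enum //.
by rewrite e nth_index // mem_enum.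
Qed.

(** Draw the cliques with straight edges side by side in the plane, the i-th one
    in the strip of abscissas between 10 i and 10 i + 3, and project to the
    sphere. *)
Theorem four_K4_in_sphere (K : realType) (V : finType) (adj : rel V) (cls : V -> 'I_4) :
  (forall u v, adj u v = (u != v) && (cls u == cls v)) ->
  (forall v, (#|[set u | cls u == cls v]%SET| <= 4)%N) ->
  embeds_in adj (@sphere_with_handles K 0).
Proof.
move=> adjE small.
pose A v := [set u | cls u == cls v]%SET.
have AA v : v \in A v by rewrite inE.
pose idx v : 'I_4 := inord (index v (enum (A v))).
have idx_inj u v : cls u = cls v -> idx u = idx v -> u = v.
  move=> cuv; have AE : A u = A v by rewrite /A cuv.
  have lt4 w : (index w (enum (A w)) < 4)%N.
    by apply: leq_trans (small w); rewrite cardE index_mem mem_enum AA.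
  move=> /(congr1 (@nat_of_ord 4)); rewrite !inordK ?lt4 // AE.
  by apply: index_enum_inj; rewrite // -AE.
pose X v : K := 10 * (cls v : nat)%:R + K4x K (idx v).
pose Y v : K := K4y K (idx v).
pose arc u v t := inv_stereographic (X u + t * (X v - X u), Y u + t * (Y v - Y u)).
have adj_cls u v : adj u v -> cls u = cls v by rewrite adjE => /andP[_ /eqP].
have adj_idx u v : adj u v -> idx u != idx v.
  rewrite adjE => /andP[uv /eqP cuv]; apply: contra_neq uv; exact: idx_inj.
have XE u v t : adj u v ->
    X u + t * (X v - X u) = 10 * (cls u : nat)%:R + (K4x K (idx u) + t * (K4x K (idx v) - K4x K (idx u))).
  by move=> /adj_cls e; rewrite /X e; ring.
have segment_bounds u v t : 0 <= t <= 1 ->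
    0 <= K4x K (idx u) + t * (K4x K (idx v) - K4x K (idx u)) <= 3.
  by move=> t01; have := K4x_bounds K (idx u); have := K4x_bounds K (idx v); nra.
have class_sep (i j : 'I_4) (a b : K) : 0 <= a <= 3 -> 0 <= b <= 3 ->
    10 * (i : nat)%:R + a = 10 * (j : nat)%:R + b -> i = j /\ a = b.
  move=> a3 b3 e; suff ij : i = j by split => //; rewrite ij in e; lra.
  apply: val_inj; case: (ltngtP i j) => // lt; exfalso.
    have : (i.+1%:R <= j%:R :> K) by rewrite ler_nat.
    by rewrite -natr1; lra.
  have : (j.+1%:R <= i%:R :> K) by rewrite ler_nat.
  by rewrite -natr1; lra.
exists (fun v => inv_stereographic (X v, Y v)), arc; split.
- split=> [u v /inv_stereographic_inj[ex ey]|v]; last exact: inv_stereographic_sphere.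
  have [cuv kuv] := class_sep _ _ _ _ (K4x_bounds K (idx u)) (K4x_bounds K (idx v)) ex.
  by apply: idx_inj => //; apply: K4_vertex_inj kuv ey.
- move=> u v uv; split.
  + apply: continuous_subspaceT; apply: inv_stereographic_continuous => t;
      (apply: cvgD; [exact: cvg_cst | apply: cvgM; [exact: cvg_id | exact: cvg_cst]]).
  + move=> s t _ _ /inv_stereographic_inj[].
    rewrite !XE // => /addrI; exact/K4_segment_inj/adj_idx.
  + by move=> t _; exact: inv_stereographic_sphere.
  + by rewrite /arc !mul0r !addr0.
  + by rewrite /arc !mul1r ![_ + (_ - _)]addrC !subrK.
- by move=> u v _ t _; congr (inv_stereographic (_, _)); ring.
- move=> u v w uv t t01 /inv_stereographic_inj[]; rewrite XE // => ex.
  have t01' : 0 <= t <= 1 by rewrite in_itv /= in t01; lra.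
  have [_ ex'] := class_sep _ _ _ _ (segment_bounds u v t t01') (K4x_bounds K (idx w)) ex.
  exact: (K4_segment_vertex (adj_idx _ _ uv) t01 ex').
move=> u v u' v' uv uv' ne ne' t t' t01 t01' /inv_stereographic_inj[]; rewrite !XE // => ex ey.
have l (t0 : K) : t0 \in `]0, 1[%R -> 0 <= t0 <= 1 by rewrite in_itv /=; lra.
have [c e] := class_sep _ _ _ _ (segment_bounds u v t (l _ t01)) (segment_bounds u' v' t' (l _ t01')) ex.
have cv := adj_cls _ _ uv; have cv' := adj_cls _ _ uv'.
have [[e1 e2]|[e1 e2]] := K4_segments_disjoint (adj_idx _ _ uv) (adj_idx _ _ uv') t01 t01' e ey.
  by apply: ne; rewrite (idx_inj u u') // (idx_inj v v') // -cv -cv'.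
have eu : u = v' by apply: idx_inj; rewrite // -cv'.
have ev : v = u' by apply: idx_inj; rewrite // -cv.
by apply: ne'; rewrite eu ev.
Qed.

Local Close Scope classical_set_scope.

(** * The commuting graph *)

Theorem proposition3p5 (K : realType) (R : finZmodType) (mul : R -> R -> R)
    (mulA : associative mul)
    (mulDl : left_distributive mul +%R)
    (mulDr : right_distributive mul +%R)
    (R5 : n_centralizer mul 5) :
  [/\ integral_graph (commuting_graph mul),
      ~ toroidal K (commuting_graph mul)
    & planar K (commuting_graph mul) <->
        #|ring_center mul| = 1%N \/ #|ring_center mul| = 2%N].
Proof.
have [cls0 [comm card0]] := commuting_classes mulDl mulDr R5.
set adj := commuting_graph mul; set n := #|ring_center mul|.
pose cls (v : commuting_vertex mul) := cls0 (val v).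
have nc (v : commuting_vertex mul) : val v \notin ring_center mul by case: v.
have adjE u v : adj u v = (u != v) && (cls u == cls v).
  by rewrite /adj /commuting_graph comm ?nc.
have adjC : symmetric adj by move=> u v; rewrite !adjE eq_sym [cls u == _]eq_sym.
have clsm i : #|[set v | cls v == i]%SET| = (2 * n)%N.
  rewrite -(card0 i) -(card_imset _ val_inj); apply: eq_card => x.
  apply/imsetP/idP => [[v vi ->]|].
    by rewrite inE in vi; rewrite inE vi nc.
  rewrite inE => /andP[xnc xi].
  by exists (Sub x xnc : commuting_vertex mul); rewrite ?inE /cls ?SubK.
have n_gt0 : (0 < n)%N.
  rewrite /n; apply/card_gt0P; exists 0; rewrite inE; apply/forallP => s.
  have m0s : mul 0 s = 0 by have := mulDl 0 0 s; rewrite addr0 => /esym/eqP; rewrite -subr_eq0 addrK => /eqP.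
  have ms0 : mul s 0 = 0 by have := mulDr s 0 0; rewrite addr0 => /esym/eqP; rewrite -subr_eq0 addrK => /eqP.
  by rewrite m0s ms0.
have planar_small : (n <= 2)%N -> embeds_in adj (@sphere_with_handles K 0).
  by move=> n2; apply: (four_K4_in_sphere K adjE) => v; rewrite clsm; lia.
have clique i k : (k <= 2 * n)%N -> exists w : 'I_k -> commuting_vertex mul,
    [/\ injective w, forall a, cls (w a) = i & forall a b, a != b -> adj (w a) (w b)].
  rewrite -(clsm i) => kn; pose w (a : 'I_k) := enum_val (widen_ord kn a).
  have wI : injective w by move=> a b /enum_val_inj /(congr1 val) /= ab; apply: val_inj.
  have wi a : cls (w a) = i by have := enum_valP (widen_ord kn a); rewrite inE => /eqP.
  by exists w; split => // a b ab; rewrite adjE (inj_eq wI) ab !wi eqxx.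
split.
- exact: (clique_union_integral adjE (fun v => clsm (cls v))).
- case=> tor nosphere; have [n2|n3] := leqP n 2.
    exact: nosphere 0%N isT (planar_small n2).
  have [|w [wI wi wadj]] := clique ord0 5; first by lia.
  have [|w' [wI' wi' wadj']] := clique ord_max 5; first by lia.
  apply: (two_K5_not_in_torus adjC wI wI' _ wadj wadj' tor) => i j.
  by apply: contra_eq_neq (wi i) => ->; rewrite wi'.
split=> [[sph _]|n12].
  have [n2|n3] := leqP n 2; first by lia.
  have [|w [wI wi wadj]] := clique ord0 6; first by lia.
  by case: (K6_not_in_sphere adjC wI wadj sph).
by split=> //; apply: planar_small; lia.
Qed.
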